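(* Let $k\ge 2$ and let $\nu=\nu_0+(S^T)^{k-1}\nu_{k-1}\in I^1_{-,0,k-1}$ be a generic element, i.e. all entries of the diagonal operator $\nu_{k-1}$ are nonzero. Let $\mathcal O_\nu=\{(\operatorname{Ad}^{+,k})^*_{g^{-1}}\nu\mid g\in GI^\infty_{+,0,k-1}\}$ be its coadjoint orbit. Then: (i) One has $$Z(GI^\infty_{+,0,k-1})=(GI^\infty_{+,0,k-1})_\nu=GL_0^{\infty,k-1},$$ where $Z(GI^\infty_{+,0,k-1})$ is the center of $GI^\infty_{+,0,k-1}$ and $(GI^\infty_{+,0,k-1})_\nu$ is the stabilizer of $\nu$ under the coadjoint action. (ii) The generic orbit $\mathcal O_\nu\cong GI^\infty_{+,0,k-1}/GL_0^{\infty,k-1}$ is a Banach Lie group. (iii) One has $\mathcal O_\nu=\nu_0+\mathcal O_{(S^T)^{k-1}\nu_{k-1}}$.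
   Context: Let $\mathcal H$ be a real separable Hilbert space with orthonormal basis $\{|n\rangle\}_{n\ge0}$. Sequences in $\ell^\infty$ (resp. $\ell^1$) are identified with bounded (resp. trace class) diagonal operators; products are componentwise. $S=\sum_{n\ge0}|n\rangle\langle n+1|$ is the shift operator and $S^T$ its adjoint. For a diagonal operator $x=(x_0,x_1,\dots)$ put $s(x)=(x_1,x_2,\dots)$, $\tilde s(x)=(0,x_0,x_1,\dots)$. $GI^\infty_{+,0,k-1}$ is the Banach Lie group of elements $g=g_0+g_{k-1}S^{k-1}$ with $g_0,g_{k-1}\in\ell^\infty$ and the entries of $g_0$ bounded below by a strictly positive number (depending on $g_0$), with product $$g\circ_kh=g_0h_0+\big(g_0h_{k-1}+g_{k-1}s^{k-1}(h_0)\big)S^{k-1}.$$ Its Lie algebra is $I^\infty_{+,0,k-1}=\{x_0+x_{k-1}S^{k-1}\mid x_0,x_{k-1}\in\ell^\infty\}$. The predual of the latter is $I^1_{-,0,k-1}=\{\rho_0+(S^T)^{k-1}\rho_{k-1}\mid\rho_0,\rho_{k-1}\in\ell^1\}$ with pairing $\langle\rho,x\rangle=\operatorname{Tr}(\rho x)=\operatorname{Tr}(\rho_0x_0)+\operatorname{Tr}(\rho_{k-1}x_{k-1})$. The coadjoint action is $\langle(\operatorname{Ad}^{+,k})^*_{g^{-1}}\rho,x\rangle=\langle\rho,g^{-1}\circ_kx\circ_kg\rangle$, explicitly $$(\operatorname{Ad}^{+,k})^*_{g^{-1}}\rho=\rho_0+g_0^{-1}g_{k-1}\rho_{k-1}-\tilde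 s^{k-1}(g_0^{-1}g_{k-1}\rho_{k-1})+(S^T)^{k-1}s^{k-1}(g_0)g_0^{-1}\rho_{k-1}.$$ $GL_0^{\infty,k-1}$ is the subgroup of diagonal elements $g_0$ of $GI^\infty_{+,0,k-1}$ that are $(k-1)$-periodic: $s^{k-1}(g_0)=g_0$. In (ii), $\mathcal O_\nu$ carries the structure transported by the bijection $[g]\mapsto(\operatorname{Ad}^{+,k})^*_{g^{-1}}\nu$. *)

(* Defs.v *)
From HB Require Import structures.
From mathcomp Require Import all_boot all_order all_algebra.
From mathcomp Require Import all_classical all_reals all_analysis.
From mathcomp Require Import ring lra.

Set Implicit Arguments.
Unset Strict Implicit.
Unset Printing Implicit Defensive.

Import Order.TTheory GRing.Theory Num.Theory.
Import numFieldNormedType.Exports.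

Local Open Scope classical_set_scope.
Local Open Scope ring_scope.

(** * The Banach space l^oo of bounded real sequences *)

Section Linfty.
Context {R : realType}.

Definition linfty_pred : {pred nat -> R} := mem (bounded_fun : set (nat -> R)).

Lemma linftyP (x : nat -> R) :
  reflect (exists M, forall n, `|x n| <= M) (x \in linfty_pred).
Proof.
apply: (iffP idP) => [|[M xM]].
- rewrite inE => -[M [Mreal xM]]; exists (M + 1) => n.
  by apply: (xM (M + 1)) => //; rewrite ltrDl.
- rewrite inE; exists M; split; first exact: num_real.
  by move=> N MN n _; apply: le_trans (xM n) (ltW MN).
Qed.

Fact linfty_subring : subring_closed linfty_pred.
Proof.
split.
- by apply/linftyP; exists 1 => n /=; rewrite normr1.
- move=> x y /linftyP[M xM] /linftyP[N yN]; apply/linftyP; exists (M + N) => n.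
  by rewrite (le_trans (ler_normB _ _))// lerD.
- move=> x y /linftyP[M xM] /linftyP[N yN]; apply/linftyP; exists (M * N) => n.
  by rewrite [X in `|X|]/= normrM ler_pM.
Qed.

HB.instance Definition _ := GRing.isSubringClosed.Build _ linfty_pred
  linfty_subring.

Fact linfty_submod : GRing.subsemimod_closed linfty_pred.
Proof.
split; first exact: (GRing.subring_closedB linfty_subring).
move=> a x /linftyP[M xM]; apply/linftyP; exists (`|a| * M) => n.
by rewrite [X in `|X|]/= normrM ler_wpM2l.
Qed.

End Linfty.

Definition linfty (R : realType) := {x : nat -> R | x \in linfty_pred}.

Definition linfty_fun (R : realType) (x : linfty R) : nat -> R := val x.
Coercion linfty_fun : linfty >-> Funclass.

HB.instance Definition _ (R : realType) :=
  Choice.copy (linfty R) {x : nat -> R | x \in linfty_pred}.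
HB.instance Definition _ (R : realType) :=
  SubChoice.copy (linfty R) {x : nat -> R | x \in linfty_pred}.
HB.instance Definition _ (R : realType) :=
  GRing.SubChoice_isSubComNzRing.Build _ linfty_pred (linfty R) linfty_subring.
HB.instance Definition _ (R : realType) :=
  GRing.SubZmodule_isSubLmodule.Build R (nat -> R) linfty_pred (linfty R)
    (@linfty_submod R).

Section LinftyNorm.
Context {R : realType}.
Implicit Types x y : linfty R.

Definition linfty_norm x : R := sup (range (fun n => `|x n|)).

Lemma linfty_ext x y : (forall n, x n = y n) -> x = y.
Proof. by move=> xy; apply/val_inj/funext. Qed.

Lemma linfty_bounded x : exists M, forall n, `|x n| <= M.
Proof. exact/linftyP/(valP x). Qed.

Lemma linfty_norm_ub x n : `|x n| <= linfty_norm x.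
Proof.
have [M xM] := linfty_bounded x.
apply: ub_le_sup; last by exists n.
by exists M => _ [m _ <-].
Qed.

Lemma linfty_norm_le x M : (forall n, `|x n| <= M) -> linfty_norm x <= M.
Proof.
move=> xM; apply: ge_sup; first by exists `|x 0%N|, 0%N.
by move=> _ [m _ <-].
Qed.

Lemma linftyDE x y n : linfty_fun (x + y) n = x n + y n. Proof. by []. Qed.
Lemma linftyNE x n : linfty_fun (- x) n = - x n. Proof. by []. Qed.
Lemma linftyME x y n : linfty_fun (x * y) n = x n * y n. Proof. by []. Qed.
Lemma linftyZE (a : R) x n : linfty_fun (a *: x) n = a * x n. Proof. by []. Qed.
Lemma linfty0E n : linfty_fun (0 : linfty R) n = 0. Proof. by []. Qed.
Lemma linfty1E n : linfty_fun (1 : linfty R) n = 1. Proof. by []. Qed.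

Fact linfty_ler_normD x y : linfty_norm (x + y) <= linfty_norm x + linfty_norm y.
Proof.
apply: linfty_norm_le => n; rewrite linftyDE (le_trans (ler_normD _ _))//.
by rewrite lerD// linfty_norm_ub.
Qed.

Fact linfty_normrZ (a : R) x : linfty_norm (a *: x) = `|a| * linfty_norm x.
Proof.
apply/eqP; rewrite eq_le; apply/andP; split.
  by apply: linfty_norm_le => n; rewrite linftyZE normrM ler_wpM2l// linfty_norm_ub.
have [->|a0] := eqVneq a 0.
  by rewrite normr0 mul0r (le_trans _ (linfty_norm_ub _ 0%N)).
rewrite -ler_pdivlMl ?normr_gt0//; apply: linfty_norm_le => n.
by rewrite ler_pdivlMl ?normr_gt0// -normrM -linftyZE linfty_norm_ub.
Qed.

Fact linfty_normr0_eq0 x : linfty_norm x = 0 -> x = 0.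
Proof.
move=> x0; apply: linfty_ext => n; apply/eqP.
by rewrite -normr_le0 -x0 linfty_norm_ub.
Qed.

End LinftyNorm.

HB.instance Definition _ (R : realType) := Lmodule_isNormed.Build R (linfty R)
  (@linfty_ler_normD R) (@linfty_normrZ R) (@linfty_normr0_eq0 R).

Fact linfty_complete (R : realType) (F : set_system (linfty R)) :
  ProperFilter F -> cauchy F -> cvg F.
Proof.
move=> FF /cauchy_ballP Fc.
pose ev n : linfty R -> R := fun x => x n.
have evc n : cvg (ev n @ F).
  apply: cauchy_cvg; apply/cauchyP => e e0.
  have /cauchy_ballP/cauchyP/(_ e e0)[x Fx] := Fc; exists (linfty_fun x n).
  apply: (@filterS _ F _ _ _ _ Fx) => y; rewrite -ball_normE /= => xy.
  exact: le_lt_trans (linfty_norm_ub (x - y) n) xy.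
pose l n : R := lim (ev n @ F).
have Fl e : 0 < e -> \forall x \near F, forall n, `|l n - linfty_fun x n| <= e.
  move=> e0.
  have e20 : 0 < e / 2 by rewrite divr_gt0.
  have := Fc _ e20; rewrite /prop_near2 => -[[A B] [/= FA FB]] AB.
  near=> x => n.
  have Ax : A x by near: x.
  have := evc n => /cvgrPdist_lt /(_ _ e20) ln.
  have [y [By /= lny]] := @filter_ex _ F _ _ (filterI FB ln).
  have := AB (x, y) (conj Ax By).
  rewrite -ball_normE /ball_ /= => xy.
  have xyn := le_lt_trans (linfty_norm_ub (x - y) n) xy.
  rewrite linftyDE linftyNE in xyn.
  rewrite (_ : l n - _ = (l n - linfty_fun y n)
                         - (linfty_fun x n - linfty_fun y n)); last by ring.
  by rewrite (le_trans (ler_normB _ _))// [leRHS](splitr e) lerD// ltW.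
have lb : l \in linfty_pred.
  have [x xl] := @filter_ex _ F _ _ (Fl 1 ltr01).
  have [M xM] := linfty_bounded x; apply/linftyP; exists (1 + M) => n.
  rewrite -[l n](subrK (linfty_fun x n)) (le_trans (ler_normD _ _))// lerD//.
apply/cvg_ex; exists (exist _ l lb : linfty R).
apply/cvgrPdist_le => e e0; near=> x.
by apply: linfty_norm_le => n; move: n; near: x; exact: Fl.
Unshelve. all: by end_near. Qed.

HB.instance Definition _ (R : realType) :=
  Uniform_isComplete.Build (linfty R) (@linfty_complete R).

(** * Banach manifolds and Banach Lie groups *)

(** [Cn n U f]: [f] is of class C^n on the open set [U]. The recursion is on the
    tangent map [(x, v) |-> 'd f x v], which avoids norming the spaces of
    multilinear maps. For a finite [n] this asks only for strong continuity of
    the [n]-th differential, but [smooth_on] is the usual (Frechet) class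
    C^oo. Only the germs of [f] at the points of [U] matter. *)
Fixpoint Cn (R : realType) (n : nat) :
    forall E F : normedModType R, set E -> (E -> F) -> Prop :=
  match n with
  | 0%N => fun E F U f => forall x, U x -> {for x, continuous f}
  | m.+1 => fun E F U f =>
      (forall x, U x -> differentiable f x) /\
      @Cn R m (E * E)%type F (U `*` setT) (fun p => 'd f (p.1) p.2)
  end.

Definition smooth_on (R : realType) (E F : normedModType R) (U : set E)
  (f : E -> F) : Prop := forall n, Cn n U f.

(** [cmap] is meaningful on [cdom] only, [cinv] on the image of [cdom] only. *)
Record chart (T E : Type) := Chart {
  cdom : set T;
  cmap : T -> E;
  cinv : E -> T
}.

Definition is_atlas (R : realType) (T : Type) (E : normedModType R)
    (A : set (chart T E)) : Prop :=
  [/\ forall x, exists2 c, A c & cdom c x,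
      forall c, A c -> {in cdom c, cancel (cmap c) (cinv c)} &
      forall c d, A c -> A d ->
        open (cmap c @` (cdom c `&` cdom d)) /\
        smooth_on (cmap c @` (cdom c `&` cdom d)) (cmap d \o cinv c)].

Definition atlas_open (R : realType) (T : Type) (E : normedModType R)
    (A : set (chart T E)) (O : set T) : Prop :=
  forall c, A c -> open (cmap c @` (cdom c `&` O)).

Definition atlas_hausdorff (R : realType) (T : Type) (E : normedModType R)
    (A : set (chart T E)) : Prop :=
  forall x y, x <> y -> exists O1 O2,
    [/\ atlas_open A O1, atlas_open A O2, O1 x, O2 y & O1 `&` O2 = set0].

Definition prod_chart (S T E F : Type) (c : chart S E) (d : chart T F) :
    chart (S * T) (E * F) :=
  Chart (cdom c `*` cdom d) (fun p => (cmap c p.1, cmap d p.2))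
        (fun q => (cinv c q.1, cinv d q.2)).

Definition prod_atlas (S T E F : Type) (A : set (chart S E))
    (B : set (chart T F)) : set (chart (S * T) (E * F)) :=
  [set e | exists c d, [/\ A c, B d & e = prod_chart c d]].

Definition smooth_map (R : realType) (S T : Type) (E F : normedModType R)
    (A : set (chart S E)) (B : set (chart T F)) (f : S -> T) : Prop :=
  forall x c d, A c -> B d -> cdom c x -> cdom d (f x) ->
  exists U : set E,
    [/\ open U, U (cmap c x), U `<=` cmap c @` cdom c,
        U `<=` [set y | cdom d (f (cinv c y))] &
        smooth_on U (cmap d \o f \o cinv c)].

(** A smooth map whose differential at every point is onto with complemented
    kernel, i.e., has a continuous linear right inverse. *)
Definition submersion (R : realType) (S T : Type) (E F : normedModType R)
    (A : set (chart S E)) (B : set (chart T F)) (f : S -> T) : Prop :=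
  smooth_map A B f /\
  forall x c d, A c -> B d -> cdom c x -> cdom d (f x) ->
  exists2 h : {linear F -> E}, continuous h &
    forall v, 'd (cmap d \o f \o cinv c) (cmap c x) (h v) = v.

(** Banach Lie group structures on the set [T]. *)
Record banach_lie_group (R : realType) (T : Type) := BanachLieGroup {
  blg_mul : T -> T -> T;
  blg_one : T;
  blg_inv : T -> T;
  blg_mulA : associative blg_mul;
  blg_mul1 : left_id blg_one blg_mul;
  blg_mulV : left_inverse blg_one blg_inv blg_mul;
  blg_model : completeNormedModType R;
  blg_atlas : set (chart T blg_model);
  blg_atlasP : is_atlas blg_atlas;
  blg_hausdorff : atlas_hausdorff blg_atlas;
  blg_mul_smooth :
    smooth_map (prod_atlas blg_atlas blg_atlas) blg_atlas
      (fun p => blg_mul p.1 p.2);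
  blg_inv_smooth : smooth_map blg_atlas blg_atlas blg_inv
}.
Arguments blg_mul {R T} b _ _.
Arguments blg_atlas {R T} b.

(** * Center and coset spaces of abstract groups *)

Definition group_center (G : groupType) : set G :=
  [set z | forall g : G, (z * g = g * z)%g].
Arguments group_center : clear implicits.

Definition left_coset (G : groupType) (N : set G) (g : G) : set G :=
  [set (g * n)%g | n in N].

(** The set [G / N] and the canonical projection [G -> G / N]. *)
Definition coset_space (G : groupType) (N : set G) : set (set G) :=
  range (left_coset N).

Definition coset_proj (G : groupType) (N : set G) (g : G) : coset_space N :=
  exist _ (left_coset N g) (mem_set (imageT (left_coset N) g)).

(** * The group GI^oo_{+,0,k-1} *)

Section Shift.
Context {R : realType}.
Implicit Types x : nat -> R.

Definition sh x : nat -> R := fun n => x n.+1.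
Definition sht x : nat -> R := fun n => if n is m.+1 then x m else 0.

Lemma iter_shE m x n : iter m sh x n = x (n + m)%N.
Proof. by elim: m n => [|m IH] n /=; rewrite ?addn0// /sh IH addSnnS. Qed.

Fact sh_linfty (x : linfty R) : sh x \in linfty_pred.
Proof. by have [M xM] := linfty_bounded x; apply/linftyP; exists M => n; exact: xM. Qed.

Definition linfty_sh (x : linfty R) : linfty R := exist _ (sh x) (sh_linfty x).

Lemma iter_linfty_shE m (x : linfty R) n :
  linfty_fun (iter m linfty_sh x) n = x (n + m)%N.
Proof.
elim: m n => [|m IH] n; first by rewrite addn0.
by rewrite -addSnnS -IH.
Qed.

End Shift.

(** The pair [(x_0, x_{k-1})] stands for [x_0 + x_{k-1} S^{k-1}]; for [k >= 2]
    the two components are determined by the operator. *)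
Definition Iinfty (R : realType) := (linfty R * linfty R)%type.

Definition imul (R : realType) (k : nat) (x y : Iinfty R) : Iinfty R :=
  (x.1 * y.1, x.1 * y.2 + x.2 * iter k.-1 linfty_sh y.1).

Definition GI_pred (R : realType) : {pred Iinfty R} :=
  mem [set g : Iinfty R | exists2 e : R, 0 < e & forall n, e <= g.1 n].

Definition GI (R : realType) (k : nat) := {g : Iinfty R | g \in @GI_pred R}.

HB.instance Definition _ (R : realType) (k : nat) :=
  SubChoice.copy (GI R k) {g : Iinfty R | g \in @GI_pred R}.

Section GIGroup.
Context {R : realType} {k : nat}.
Implicit Types g h : GI R k.

Definition GI0 g : linfty R := (val g).1.
Definition GI1 g : linfty R := (val g).2.

Lemma GI0_gt0 g n : 0 < GI0 g n.
Proof. by have := valP g; rewrite inE => -[e e0 /(_ n)]; exact: lt_le_trans. Qed.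

Lemma GI0_neq0 g n : GI0 g n != 0. Proof. by rewrite gt_eqF// GI0_gt0. Qed.

Fact GI0V_linfty g : (fun n => (GI0 g n)^-1) \in linfty_pred.
Proof.
have := valP g; rewrite inE => -[e e0 eg]; apply/linftyP; exists e^-1 => n.
by rewrite ger0_norm ?invr_ge0 ?(ltW (GI0_gt0 g n))// lef_pV2 ?posrE ?GI0_gt0.
Qed.

Definition GI0V g : linfty R :=
  exist (fun x => x \in linfty_pred) _ (GI0V_linfty g).

Fact GI_one_subproof : ((1, 0) : Iinfty R) \in @GI_pred R.
Proof. by rewrite inE; exists 1. Qed.

Fact GI_mul_subproof g h : imul k (val g) (val h) \in @GI_pred R.
Proof.
have := valP g; rewrite inE => -[e e0 eg].
have := valP h; rewrite inE => -[f f0 fh].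
rewrite inE; exists (e * f); first exact: mulr_gt0.
by move=> n; rewrite linftyME ler_pM// ltW.
Qed.

Fact GI_inv_subproof g :
  (GI0V g, - (GI0V g * GI1 g * iter k.-1 linfty_sh (GI0V g))) \in @GI_pred R.
Proof.
have [M gM] := linfty_bounded (GI0 g).
have M0 : 0 < M.
  by rewrite (lt_le_trans (GI0_gt0 g 0%N))// (le_trans (ler_norm _) (gM 0%N)).
rewrite inE; exists M^-1; first by rewrite invr_gt0.
move=> n; rewrite /= lef_pV2 ?posrE ?GI0_gt0//.
exact: le_trans (ler_norm _) (gM n).
Qed.

Definition GI_one : GI R k :=
  exist (fun x => x \in @GI_pred R) _ GI_one_subproof.
Definition GI_mul g h : GI R k :=
  exist (fun x => x \in @GI_pred R) _ (GI_mul_subproof g h).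
Definition GI_inv g : GI R k :=
  exist (fun x => x \in @GI_pred R) _ (GI_inv_subproof g).

Lemma GI_ext g h : (forall n, GI0 g n = GI0 h n) ->
  (forall n, GI1 g n = GI1 h n) -> g = h.
Proof.
move=> /linfty_ext g0 /linfty_ext g1; apply: val_inj; move: g0 g1.
by rewrite /GI0 /GI1; case: (val g) (val h) => [? ?] [? ?] /= -> ->.
Qed.

Lemma GI0_mulE g h n : GI0 (GI_mul g h) n = GI0 g n * GI0 h n.
Proof. by []. Qed.

Lemma GI1_mulE g h n : GI1 (GI_mul g h) n =
  GI0 g n * GI1 h n + GI1 g n * GI0 h (n + k.-1)%N.
Proof. by rewrite /GI1 /= linftyDE !linftyME iter_linfty_shE. Qed.

Lemma GI0_invE g n : GI0 (GI_inv g) n = (GI0 g n)^-1.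
Proof. by []. Qed.

Lemma GI1_invE g n : GI1 (GI_inv g) n =
  - ((GI0 g n)^-1 * GI1 g n * (GI0 g (n + k.-1)%N)^-1).
Proof. by rewrite [LHS]linftyNE !linftyME iter_linfty_shE. Qed.

Fact GI_mulA : associative GI_mul.
Proof.
by move=> a b c; apply: GI_ext => n; rewrite !(GI0_mulE, GI1_mulE); ring.
Qed.

Fact GI_mul1 : left_id GI_one GI_mul.
Proof.
move=> a; apply: GI_ext => n; rewrite !(GI0_mulE, GI1_mulE) /GI0 /GI1 /=.
  by rewrite mul1r.
by rewrite linfty1E linfty0E mul0r mul1r addr0.
Qed.

Fact GI_mulr1 : right_id GI_one GI_mul.
Proof.
move=> a; apply: GI_ext => n; rewrite !(GI0_mulE, GI1_mulE) /GI0 /GI1 /=.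
  by rewrite mulr1.
by rewrite linfty1E linfty0E mulr0 mulr1 add0r.
Qed.

Fact GI_mulV : left_inverse GI_one GI_inv GI_mul.
Proof.
move=> a; apply: GI_ext => n; rewrite !(GI0_mulE, GI1_mulE, GI0_invE, GI1_invE).
  by rewrite mulVf// GI0_neq0.
rewrite [RHS]linfty0E; field.
by rewrite !GI0_neq0.
Qed.

Fact GI_mulrV : right_inverse GI_one GI_inv GI_mul.
Proof.
move=> a; apply: GI_ext => n; rewrite !(GI0_mulE, GI1_mulE, GI0_invE, GI1_invE).
  by rewrite mulfV// GI0_neq0.
rewrite [RHS]linfty0E; field.
by rewrite !GI0_neq0.
Qed.

End GIGroup.

HB.instance Definition _ (R : realType) (k : nat) := isGroup.Build (GI R k)
  (@GI_mulA R k) (@GI_mul1 R k) (@GI_mulr1 R k) (@GI_mulV R k) (@GI_mulrV R k).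

(** As an open subset of the Banach space [Iinfty R], [GI R k] has a global
    chart, the inclusion. *)
Definition GI_chart (R : realType) (k : nat) : chart (GI R k) (Iinfty R) :=
  Chart setT val (insubd (1%g : GI R k)).

Definition GI_atlas (R : realType) (k : nat) : set (chart (GI R k) (Iinfty R)) :=
  [set GI_chart R k].
Arguments GI_atlas : clear implicits.

(** The diagonal [(k-1)]-periodic elements. *)
Definition GL0 (R : realType) (k : nat) : set (GI R k) :=
  [set g | GI1 g = 0 /\ iter k.-1 linfty_sh (GI0 g) = GI0 g].
Arguments GL0 : clear implicits.

(** * The predual I^1_{-,0,k-1} and the coadjoint action *)

(** The pair [(rho_0, rho_{k-1})] stands for
    [rho_0 + (S^T)^{k-1} rho_{k-1}]. *)
Notation seq2 R := ((nat -> R) * (nat -> R))%type.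

Definition l1 (R : realType) : set (nat -> R) :=
  [set a : nat -> R | cvgn [normed series a]].

Definition predual (R : realType) : set (seq2 R) :=
  [set rho | l1 rho.1 /\ l1 rho.2].

Definition pairing (R : realType) (rho : seq2 R) (x : Iinfty R) : R :=
  limn (series (fun n => rho.1 n * x.1 n)) +
  limn (series (fun n => rho.2 n * x.2 n)).

(** [coad g rho] is [(Ad^{+,k})^*_{g^-1} rho]. *)
Definition coad (R : realType) (k : nat) (g : GI R k) (rho : seq2 R) : seq2 R :=
  let a : nat -> R := fun n => (GI0 g n)^-1 * GI1 g n * rho.2 n in
  (rho.1 + a - iter k.-1 sht a,
   fun n => iter k.-1 sh (GI0 g) n * (GI0 g n)^-1 * rho.2 n).

Definition coad_orbit (R : realType) (k : nat) (rho : seq2 R) : set (seq2 R) :=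
  range (fun g : GI R k => coad g rho).

Definition coad_stabilizer (R : realType) (k : nat) (rho : seq2 R) :
  set (GI R k) := [set g | coad g rho = rho].
Arguments coad_stabilizer {R} k rho.

(** The action [coad] preserves the predual, and satisfies
    <(Ad^{+,k})^*_{g^-1} rho, x> = <rho, g^-1 o_k x o_k g> ([coad_pairing]). *)
Section Summable.
Context {R : realType}.
Implicit Types a b : nat -> R.

Fact l1_le a b : (forall n, `|a n| <= `|b n|) -> l1 b -> l1 a.
Proof.
move=> ab lb; apply: series_le_cvg lb => n; rewrite ?normr_ge0//.
exact: ab.
Qed.

Fact l1D a b : l1 a -> l1 b -> l1 (a + b).
Proof.
move=> la lb.
have lab : cvgn (series (fun n => `|a n| + `|b n|)).
  by apply: is_cvg_seriesD.
apply: series_le_cvg lab => n; rewrite ?normr_ge0 ?addr_ge0//.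
exact: ler_normD.
Qed.

Fact l1N a : l1 a -> l1 (- a).
Proof. by apply: l1_le => n; rewrite [X in `|X|]/= normrN. Qed.

Fact l1M a (x : nat -> R) (M : R) : (forall n, `|x n| <= M) -> l1 a ->
  l1 (fun n => a n * x n).
Proof.
move=> xM la.
have lM : cvgn (series (fun n => M * `|a n|)) by apply: is_cvg_seriesZ.
have M0 : 0 <= M by apply: le_trans (xM 0%N).
apply: series_le_cvg lM => n; rewrite ?normr_ge0 ?mulr_ge0//.
by rewrite /= normrM mulrC ler_wpM2r.
Qed.

Fact l1_cvg a : l1 a -> cvgn (series a).
Proof. exact: (@normed_cvg R R^o). Qed.

Fact series_sht a : series (sht a) = (fun n => series a n.-1).
Proof.
apply/funext => -[|n]; first by rewrite /series/= !big_geq.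
by rewrite /series/= big_nat_recl//= add0r.
Qed.

Fact l1_sht a : l1 a -> l1 (sht a).
Proof.
have E : [normed series (sht a)] = (fun n => [normed series a] n.-1).
  rewrite -series_sht; congr series.
  by apply/funext => -[|n] //=; rewrite normr0.
rewrite /l1 /mkset E => /cvg_ex[l al]; apply/cvg_ex; exists l.
by rewrite -cvg_shiftS.
Qed.

Fact lim_sht a : l1 a -> limn (series (sht a)) = limn (series a).
Proof.
move=> /l1_cvg la; rewrite series_sht; apply/cvg_lim => //.
by rewrite -cvg_shiftS.
Qed.

Fact l1_iter_sht m a : l1 a -> l1 (iter m sht a).
Proof. by elim: m => // m IH /IH; exact: l1_sht. Qed.

Fact lim_iter_sht m a (x : linfty R) : l1 a ->
  limn (series (fun n => iter m sht a n * x n)) =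
  limn (series (fun n => a n * x (n + m)%N)).
Proof.
move=> la; elim: m x => [|m IH] x.
  by congr (limn (series _)); apply/funext => n; rewrite addn0.
have [M xM] := linfty_bounded x.
under [X in _ = limn (series X)]eq_fun do rewrite -addSnnS.
rewrite -(IH (linfty_sh x)) -[RHS]lim_sht; last first.
  by apply: (l1M (M := M)) => [n|]; [exact: xM|exact: l1_iter_sht].
by congr (limn (series _)); apply/funext => -[|n] //=; rewrite mul0r.
Qed.

End Summable.

Section Pairing.
Context {R : realType}.

Fact lim_series_add (a b : nat -> R) : cvgn (series a) -> cvgn (series b) ->
  limn (series (fun n => a n + b n)) = limn (series a) + limn (series b).
Proof. exact: lim_seriesD. Qed.

Fact lim_series_sub (a b : nat -> R) : cvgn (series a) -> cvgn (series b) ->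
  limn (series (fun n => a n - b n)) = limn (series a) - limn (series b).
Proof. exact: lim_seriesB. Qed.

Variable k : nat.
Implicit Types (g : GI R k) (rho : seq2 R).

Let a g rho : nat -> R := fun n => (GI0 g n)^-1 * GI1 g n * rho.2 n.

Fact coad_l1 g rho : l1 rho.2 -> l1 (a g rho).
Proof.
move=> lr; have [M gM] := linfty_bounded (GI0V g * GI1 g).
suff -> : a g rho = (fun n => rho.2 n * (GI0V g * GI1 g : linfty R) n).
  exact: l1M lr.
by apply/funext => n; rewrite linftyME mulrC.
Qed.

Lemma coad_predual g rho : predual rho -> predual (coad g rho).
Proof.
move=> [l0 l2]; have la := @coad_l1 g _ l2; split => /=.
  by apply: l1D; [exact: l1D|apply/l1N/l1_iter_sht].
have [M gM] := linfty_bounded (iter k.-1 linfty_sh (GI0 g) * GI0V g).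
rewrite (_ : (fun _ => _) = (fun n => rho.2 n *
   (iter k.-1 linfty_sh (GI0 g) * GI0V g : linfty R) n)).
  exact: l1M l2.
by apply/funext => n; rewrite linftyME iter_linfty_shE iter_shE mulrC.
Qed.

Lemma coad_pairing g rho (x : Iinfty R) : predual rho ->
  pairing (coad g rho) x =
  pairing rho (imul k (imul k (val (g^-1)%g) x) (val g)).
Proof.
move=> lr; have [l0 l2] := lr; have la := @coad_l1 g _ l2.
have [_ lc2] := @coad_predual g _ lr.
have cvgM b (y : linfty R) : l1 b -> cvgn (series (fun n => b n * y n)).
  by move=> lb; have [M yM] := linfty_bounded y; apply/l1_cvg/(l1M yM).
case: x => x0 x1; rewrite /pairing.
set c2 := (coad g rho).2.
set y := imul _ _ _.
have y0 n : y.1 n = x0 n.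
  rewrite /y /imul/= !linftyME/= -[(val g).1]/(GI0 g) mulrAC.
  rewrite -[linfty_fun (GI0V g) n]/((GI0 g n)^-1).
  by rewrite mulVf ?mul1r// GI0_neq0.
pose t := iter k.-1 linfty_sh x0.
have y1 n : rho.2 n * y.2 n = a g rho n * x0 n + c2 n * x1 n - a g rho n * t n.
  rewrite /y /imul/= !(linftyDE, linftyME, iter_linfty_shE)/=.
  rewrite !(linftyNE, linftyME, iter_linfty_shE) /t.
  rewrite /c2 /coad /= iter_shE /a.
  rewrite -[(val g).1]/(GI0 g) -[(val g).2]/(GI1 g).
  rewrite -[linfty_fun (GI0V g) n]/((GI0 g n)^-1).
  rewrite -[linfty_fun (GI0V g) (n + _)%N]/((GI0 g (n + k.-1)%N)^-1).
  field.
  by rewrite !GI0_neq0.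
under [X in _ = limn (series X) + _]eq_fun do rewrite y0.
under [X in _ = _ + limn (series X)]eq_fun do rewrite y1.
rewrite lim_series_sub; [|by apply: is_cvg_seriesD; exact: cvgM|exact: cvgM].
rewrite lim_series_add; [|exact: cvgM|exact: cvgM].
have lsa := @l1_iter_sht _ k.-1 _ la.
rewrite (_ : (fun n => (coad g rho).1 n * _) = (fun n => (rho.1 n * x0 n +
   a g rho n * x0 n) - iter k.-1 sht (a g rho) n * x0 n)); last first.
  by apply/funext => n /=; rewrite !mulrDl mulNr.
rewrite lim_series_sub; [|by apply: is_cvg_seriesD; exact: cvgM|exact: cvgM].
rewrite lim_series_add; [|exact: cvgM|exact: cvgM].
rewrite lim_iter_sht//.
rewrite (_ : (fun n => a g rho n * t n) = (fun n => a g rho n * x0 (n + k.-1)%N)).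
  by rewrite /=; ring.
by apply/funext => n; rewrite iter_linfty_shE.
Qed.

End Pairing.

(* Main.v *)
(** Write m = k-1 >= 1. A point Ad*_{g^-1} nu of the orbit determines, since no
    entry of nu_{k-1} vanishes, the sequences g_0(n+m)/g_0(n) and g_1(n)/g_0(n)
    and nothing more. Hence the fibers of g |-> Ad*_{g^-1} nu are the cosets of
    the m-periodic diagonal elements, which are exactly the central ones.

    One should not use these ratios as coordinates: the range of s^m - 1 on
    l^oo is not closed. Instead every coset contains a unique element whose first
    m diagonal entries are 1, obtained by dividing g by the m-periodic extension
    of (g_0(0), ..., g_0(m-1)). The remaining entries of this normal form identify
    the orbit with an open subset of l^oo x l^oo. The group operations are
    compositions of continuous linear maps, the product of l^oo and the pointwise
    inverse, whose tangent maps are again of this kind; this gives smoothness by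
    induction on the order. *)

From HB Require Import structures.
Require Import Defs.
From mathcomp Require Import all_boot all_order all_algebra.
From mathcomp Require Import all_classical all_reals all_analysis.
From mathcomp Require Import ring lra.

Set Implicit Arguments.
Unset Strict Implicit.
Unset Printing Implicit Defensive.

Import Order.TTheory GRing.Theory Num.Theory.
Import numFieldNormedType.Exports.

Local Open Scope classical_set_scope.
Local Open Scope ring_scope.

(** * Maps of class C^n *)

Section Differential.
Context {R : realType}.
Implicit Types E F G : normedModType R.

(** The estimate is the little-o expansion of [f] at [x], and uniqueness of the differential
    identifies ['d f x] with the candidate [df]. *)
Lemma diff_le E F (f : E -> F) (df : {linear E -> F}) (x : E) :
  continuous df ->
  (forall e, 0 < e -> \forall h \near (0 : E),
    `|f (h + x) - (f x + df h)| <= e * `|h|) ->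
  differentiable f x /\ 'd f x = df :> (E -> F).
Proof.
move=> dfc fe.
have dfo : f \o shift x = cst (f x) + df +o_ (0 : E) id.
  by apply/eqaddoP => e e0; exact: fe.
have dE := diff_unique dfc dfo.
by split=> //; apply/diff_locallyP; rewrite dE.
Qed.

Lemma le_linear_continuous E F (f : {linear E -> F}) (M : R) :
  (forall x, `|f x| <= M * `|x|) -> continuous f.
Proof.
move=> fM; apply/linear_bounded_continuous/linear_boundedP; near=> r.
have Mr : M <= r by near: r; apply: nbhs_pinfty_ge; exact: num_real.
by move=> x; rewrite (le_trans (fM x))// ler_wpM2r.
Unshelve. all: by end_near. Qed.

Lemma diff_near_eq E F (f g : E -> F) (x : E) :
  (\forall y \near x, f y = g y) -> differentiable f x ->
  differentiable g x /\ 'd g x = 'd f x :> (E -> F).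
Proof.
move=> fg df; apply: diff_le; first exact: diff_continuous.
move=> e e0; have := diff_locally df => /eqaddoP /(_ e e0) H.
have fgs : \forall h \near (0 : E), f (h + x) = g (h + x).
  by move: fg; rewrite (near_shift 0) subr0.
near=> h.
rewrite -(nbhs_singleton fg) -(near fgs h)//.
by near: h; exact: H.
Unshelve. all: by end_near. Qed.

Lemma open_setXT E F (U : set E) : open U -> open (U `*` [set: F]).
Proof.
move=> oU; rewrite openE => -[x y] [/= Ux _].
exists (U, setT); first by split; [exact: open_nbhs_nbhs|exact: filterT].
by move=> -[? ?] [].
Qed.

(** Openness of [U] turns agreement on [U] into agreement near each of its points, so the tangent
    maps agree over [U] and the induction continues. This replaces expressions in charts by explicit
    formulas. *)
Lemma eq_Cn n E F (U : set E) (f g : E -> F) :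
  open U -> {in U, f =1 g} -> Cn n U f -> Cn n U g.
Proof.
elim: n E F U f g => [|n IH] E F U f g oU fg /=.
  move=> cf x Ux.
  have fgx : \forall y \near x, f y = g y.
    near=> y; apply: fg; apply/mem_set; near: y.
    exact: open_nbhs_nbhs.
  move: (cf x Ux); rewrite /continuous_at /prop_for -(nbhs_singleton fgx).
  apply: cvg_trans; exact: near_eq_cvg.
move=> [df Tf].
have fgd x : U x -> differentiable g x /\ 'd g x = 'd f x :> (E -> F).
  move=> Ux; apply: diff_near_eq (df x Ux).
  near=> y; apply: fg; apply/mem_set; near: y.
  exact: open_nbhs_nbhs.
split; first by move=> x /fgd[].
apply: IH Tf; first exact: open_setXT.
move=> -[x v] /set_mem[Ux _].
exact: esym (congr1 (@^~ v) (fgd x Ux).2).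
Unshelve. all: by end_near. Qed.

Lemma CnW n E F (U : set E) (f : E -> F) : Cn n.+1 U f -> Cn n U f.
Proof.
elim: n E F U f => [|n IH] E F U f [df Tf].
  by move=> x /df; exact: differentiable_continuous.
by split=> //; exact: IH.
Qed.

Lemma Cn_differentiable n E F (U : set E) (f : E -> F) x :
  Cn n.+1 U f -> U x -> differentiable f x.
Proof. by case=> + _; exact. Qed.

(** The tangent map is [f \o snd], again continuous and linear. *)
Lemma linear_Cn n E F (U : set E) (f : {linear E -> F}) :
  continuous f -> Cn n U f.
Proof.
elim: n E F U f => [|n IH] E F U f cf /=; first by move=> x _; exact: cf.
split; first by move=> x _; exact: linear_differentiable.
have -> : (fun p : E * E => 'd f (p.1) p.2) = f \o snd.
  by apply/funext => p; rewrite (diff_lin p.1 cf).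
apply: (IH (E * E)%type F _ (f \o snd : {linear (E * E)%type -> F})) => x.
apply: continuous_comp; [exact: cvg_snd|exact: cf].
Qed.

Lemma cst_Cn n E F (U : set E) (c : F) : Cn n U (cst c : E -> F).
Proof.
case: n => [|n] /=; first by move=> x _; exact: cvg_cst.
split; first by move=> x _; exact: differentiable_cst.
have -> : (fun p : E * E => 'd (cst c : E -> F) (p.1) p.2) = (\0 : {linear (E * E)%type -> F}).
  by apply/funext => p; rewrite diff_cst.
by apply: linear_Cn => x; exact: cvg_cst.
Qed.

Lemma pair_Cn n E F G (U : set E) (f : E -> F) (g : E -> G) : open U ->
  Cn n U f -> Cn n U g -> Cn n U (fun x => (f x, g x)).
Proof.
elim: n E F G U f g => [|n IH] E F G U f g oU.
  by move=> cf cg x Ux; apply: cvg_pair; [exact: cf|exact: cg].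
move=> [df Tf] [dg Tg]; split.
  by move=> x Ux; apply: differentiable_pair; [exact: df|exact: dg].
apply: eq_Cn (IH _ _ _ _ _ _ _ Tf Tg); [exact: open_setXT| |exact: open_setXT].
move=> -[x v] /set_mem[/= Ux _].
by rewrite diff_pair//; [exact: df|exact: dg].
Qed.

(** By the chain rule the tangent map of [g \o f] is the tangent map of [g] after the pair of
    [f \o fst] and the tangent map of [f], a composition one order lower. *)
Lemma comp_Cn n E F G (U : set E) (V : set F) (f : E -> F) (g : F -> G) :
  open U -> open V -> U `<=` f @^-1` V ->
  Cn n U f -> Cn n V g -> Cn n U (g \o f).
Proof.
elim: n E F G U V f g => [|n IH] E F G U V f g oU oV UV.
  move=> cf cg x Ux; apply: continuous_comp; [exact: cf|].
  by apply: cg; exact: UV.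
move=> fn [dg Tg]; have fW := CnW fn; case: fn => df Tf; split.
  move=> x Ux; apply: differentiable_comp; [exact: df|].
  by apply: dg; exact: UV.
have oUT := @open_setXT E E _ oU.
have oVT := @open_setXT F F _ oV.
(* This is itself a composition, so the induction hypothesis applies to [fst] followed by [f], with
   [f] taken one order lower by [CnW]. *)
have f1 : Cn n (U `*` [set: E]) (f \o fst).
  apply: (IH _ _ _ _ U) => //; first by move=> -[x v] [].
  by apply: linear_Cn => x; exact: cvg_fst.
have H := pair_Cn oUT f1 Tf.
apply: eq_Cn (IH _ _ _ _ _ _ _ oUT oVT _ H Tg) => //; last first.
  by move=> -[x v] [/= /UV].
move=> -[x v] /set_mem[/= Ux _].
by rewrite (diff_comp (df x Ux) (dg _ (UV x Ux))).
Qed.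

Lemma add_Cn n E F (U : set E) (f g : E -> F) : open U ->
  Cn n U f -> Cn n U g -> Cn n U (fun x => f x + g x).
Proof.
move=> oU fn gn.
pose a : F * F -> F := fun p => p.1 + p.2.
have al : linear a.
  by move=> c p q; rewrite /a /= scalerDr addrACA.
pose aM := GRing.isLinear.Build _ _ _ _ _ al.
pose aL : {linear (F * F)%type -> F} := HB.pack a aM.
apply: (@comp_Cn n _ _ _ U setT (fun x => (f x, g x)) aL) => //.
- exact: openT.
- exact: pair_Cn.
- by apply: linear_Cn => p; exact: add_continuous.
Qed.

Lemma linear_comp_Cn n E F G (U : set E) (f : E -> F) (g : {linear F -> G}) :
  open U -> continuous g -> Cn n U f -> Cn n U (g \o f).
Proof.
by move=> oU cg fn; apply: comp_Cn oU openT _ fn _ => //; exact: linear_Cn.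
Qed.

(** The tangent map sends ((x, y), (u, v)) to b x v + b u y, a sum of copies of [b] composed with
    continuous linear projections. *)
Lemma bilinear_Cn n E F G (b : {bilinear E -> F -> G}) (U : set (E * F)) :
  open U ->
  continuous (fun p : E * F => b p.1 p.2) -> Cn n U (fun p : E * F => b p.1 p.2).
Proof.
elim: n U => [|n IH] U oU bc; first by move=> x _; exact: bc.
split; first by move=> x _; exact: differentiable_bilin.
have oUT := @open_setXT _ (E * F)%type U oU.
have -> : (fun p : (E * F) * (E * F) => 'd (fun q => b q.1 q.2) (p.1) p.2) =
  (fun p => b p.1.1 p.2.2 + b p.2.1 p.1.2).
  by apply/funext => p; rewrite diff_bilin.
have bC := IH setT openT bc.
have L (f : {linear ((E * F) * (E * F))%type -> E})
    (g : {linear ((E * F) * (E * F))%type -> F}) : continuous f -> continuous g ->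
    Cn n (U `*` [set: E * F]) (fun p => b (f p) (g p)).
  move=> cf cg; apply: (comp_Cn (V := setT) (f := fun p => (f p, g p)) oUT openT _ _ bC) => //.
  by apply: pair_Cn => //; exact: linear_Cn.
have c1 (A B : normedModType R) : continuous (fst : A * B -> A) by move=> x; exact: cvg_fst.
have c2 (A B : normedModType R) : continuous (snd : A * B -> B) by move=> x; exact: cvg_snd.
apply: add_Cn => //.
- apply: (L (fst \o fst) (snd \o snd)) => x; apply: continuous_comp;
    by [exact: c1|exact: c2].
- apply: (L (fst \o snd) (snd \o fst)) => x; apply: continuous_comp;
    by [exact: c1|exact: c2].
Qed.

End Differential.

(** * Smooth maps on l^oo *)

(** Products do not come with the join structures required by [Uniform_isComplete]. *)
HB.saturate prod.

Section ProductComplete.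
Context {R : realType} {E F : completeNormedModType R}.

(** Limits are taken componentwise. This supplies the completeness that the model space l^oo x l^oo
    of a Banach Lie group must have. *)
Lemma prod_complete (H : set_system (E * F)) :
  ProperFilter H -> cauchy H -> cvg H.
Proof.
move=> FH /cauchyP Hc.
have c1 : cvg (fst @ H).
  apply: cauchy_cvg; apply/cauchyP => e /Hc[x Hx]; exists x.1.
  by apply: (@filterS _ H _ _ _ _ Hx) => y [].
have c2 : cvg (snd @ H).
  apply: cauchy_cvg; apply/cauchyP => e /Hc[x Hx]; exists x.2.
  by apply: (@filterS _ H _ _ _ _ Hx) => y [].
apply/cvg_ex; exists (lim (fst @ H), lim (snd @ H)).
have Hp := cvg_pair c1 c2.
by move=> A /Hp; apply: (@filterS _ H) => -[].
Qed.

End ProductComplete.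

HB.instance Definition _ (R : realType) (E F : completeNormedModType R) :=
  Uniform_isComplete.Build (E * F)%type (@prod_complete R E F).

Section LinftyCalculus.
Context {R : realType}.
Implicit Types x y : linfty R.

Lemma linfty_norm_mul x y : `|x * y| <= `|x| * `|y|.
Proof.
apply: linfty_norm_le => n.
by rewrite linftyME normrM ler_pM//; exact: linfty_norm_ub.
Qed.

Definition linfty_mul x y := x * y.

Fact linfty_mul_bilinear :
  bilinear_for (GRing.Scale.Law.clone _ _ *:%R _)
    (GRing.Scale.Law.clone _ _ *:%R _) linfty_mul.
Proof.
by split=> [u|u] a x y; apply: linfty_ext => n;
  rewrite /linfty_mul !(linftyDE, linftyME, linftyZE)/=
    ?(linftyDE, linftyME, linftyZE); ring.
Qed.

HB.instance Definition _ := bilinear_isBilinear.Build R (linfty R) (linfty R)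
  (linfty R) _ _ linfty_mul linfty_mul_bilinear.

Lemma linfty_mul_continuous :
  continuous (fun p : linfty R * linfty R => linfty_mul p.1 p.2).
Proof.
move=> -[a b]; rewrite /continuous_at /=; apply/cvgrPdist_le => e e0.
(* Chosen so that |a| d + d (|b| + 1) = e; the summand 1 makes the denominator positive and also
   bounds [p.2] by |b| + 1. *)
pose d := e / (`|a| + `|b| + 1).
have ab0 : 0 < `|a| + `|b| + 1 by rewrite ltr_wpDl// addr_ge0.
have d0 : 0 < d by rewrite divr_gt0.
have /cvgrPdist_le Fa : fst @ nbhs ((a, b) : linfty R * linfty R) --> a.
  exact: cvg_fst.
have /cvgrPdist_le Fb : snd @ nbhs ((a, b) : linfty R * linfty R) --> b.
  exact: cvg_snd.
near=> p.
have pa : `|a - p.1| <= d by near: p; auto.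
have pb : `|b - p.2| <= d by near: p; auto.
have pb1 : `|b - p.2| <= 1 by near: p; auto.
have p2 : `|p.2| <= `|b| + 1.
  rewrite -[p.2](subKr b) (le_trans (ler_normB _ _))// lerD2l//.
rewrite (_ : _ - _ = a * (b - p.2) + (a - p.1) * p.2); last first.
  by rewrite /linfty_mul; ring.
rewrite (le_trans (ler_normD _ _))//.
rewrite (le_trans (lerD (linfty_norm_mul _ _) (linfty_norm_mul _ _)))//.
rewrite (@le_trans _ _ (`|a| * d + d * (`|b| + 1)))//.
  by rewrite lerD// ler_pM.
rewrite [X in _ + X]mulrC -mulrDl addrA /d mulrC divfK// gt_eqF//.
Unshelve. all: by end_near. Qed.

Lemma mul_Cn n (E : normedModType R) (U : set E) (f g : E -> linfty R) :
  open U -> Cn n U f -> Cn n U g -> Cn n U (fun z => f z * g z).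
Proof.
move=> oU fn gn.
apply: (@comp_Cn _ n _ _ _ U setT (fun z => (f z, g z))
  (fun p : linfty R * linfty R => linfty_mul p.1 p.2)) => //.
- exact: openT.
- exact: pair_Cn.
- by apply: bilinear_Cn; [exact: openT|exact: linfty_mul_continuous].
Qed.

(** The uniform lower bound, stronger than positivity of each entry, makes this set open and keeps
    the pointwise inverse bounded. *)
Definition linfty_pos : set (linfty R) :=
  [set x | exists2 e : R, 0 < e & forall n, e <= x n].

Lemma linfty_posM x y : linfty_pos x -> linfty_pos y -> linfty_pos (x * y).
Proof.
move=> [e e0 ex] [f f0 fy]; exists (e * f); first exact: mulr_gt0.
by move=> n; rewrite linftyME ler_pM// ltW.
Qed.

Lemma linfty_pos_gt0 x n : linfty_pos x -> 0 < x n.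
Proof. by move=> [e e0 /(_ n)]; exact: lt_le_trans. Qed.

Lemma linfty_pos_neq0 x n : linfty_pos x -> x n != 0.
Proof. by move=> /linfty_pos_gt0 x0; rewrite gt_eqF. Qed.

Lemma open_linfty_pos : open linfty_pos.
Proof.
rewrite openE => x [e e0 ex].
apply/nbhs_ballP; exists (e / 2); first by rewrite /= divr_gt0.
move=> y; rewrite -ball_normE /= => xy.
exists (e / 2); first by rewrite divr_gt0.
move=> n; have := le_lt_trans (linfty_norm_ub (x - y) n) xy.
rewrite linftyDE linftyNE => /ltr_normlW.
by have := ex n; lra.
Qed.

(** The pointwise inverse, with junk value [0] when it is unbounded. *)
Definition linfty_inv x : linfty R := insubd 0 (fun n => (x n)^-1).

Lemma linfty_invE x n : linfty_pos x -> linfty_inv x n = (x n)^-1.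
Proof.
move=> [e e0 ex].
rewrite -[LHS]/(val (linfty_inv x) n) val_insubd ifT//.
apply/linftyP; exists e^-1 => i.
have x0 : 0 < x i by exact: lt_le_trans (ex i).
by rewrite ger0_norm ?invr_ge0 ?(ltW x0)// lef_pV2 ?posrE.
Qed.

Lemma linfty_inv_pos x : linfty_pos x -> linfty_pos (linfty_inv x).
Proof.
move=> xp; have [M xM] := linfty_bounded x.
have M0 : 0 < M.
  exact: lt_le_trans (linfty_pos_gt0 0 xp) (le_trans (ler_norm _) (xM 0%N)).
exists M^-1; first by rewrite invr_gt0.
move=> n; rewrite linfty_invE// lef_pV2 ?posrE//; last exact: linfty_pos_gt0.
exact: le_trans (ler_norm _) (xM n).
Qed.

(** [1/(x+h) - 1/x + h/x^2 = h^2 / (x^2 (x+h))], and all denominators are bounded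
    below when [`|h| <= e / 2], where [e] is a lower bound of [x]. *)
Lemma linfty_inv_diff x : linfty_pos x ->
  differentiable linfty_inv x /\
  'd linfty_inv x = linfty_mul (- (linfty_inv x * linfty_inv x))
    :> (linfty R -> linfty R).
Proof.
move=> xp; have [e e0 ex] := xp.
set c := - (linfty_inv x * linfty_inv x).
have lc : linear (linfty_mul c : linfty R -> linfty R).
  by move=> t y z; rewrite linearPr.
pose dfM := GRing.isLinear.Build _ _ _ _ _ lc.
pose df : {linear linfty R -> linfty R} := HB.pack (linfty_mul c) dfM.
apply: (@diff_le _ _ _ _ df).
  by apply: (@le_linear_continuous _ _ _ _ `|c|) => y; exact: linfty_norm_mul.
move=> eps eps0.
near=> h.
have h1 : `|h| <= e / 2.
  by near: h; apply: nbhs0_le; rewrite divr_gt0.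
(* The denominator x^2 (x+h) is at least e * e * (e/2), so this bound on one factor |h| leaves h^2 /
   (x^2 (x+h)) at most eps |h|. *)
have h2 : `|h| <= eps * (e * e * (e / 2)).
  by near: h; apply: nbhs0_le; rewrite !mulr_gt0 ?invr_gt0.
have hxn n : e / 2 <= (h + x : linfty R) n.
  have := le_trans (linfty_norm_ub h n) h1.
  by rewrite ler_norml linftyDE => /andP[+ _]; have := ex n; lra.
have hxp : linfty_pos (h + x).
  by exists (e / 2); rewrite ?divr_gt0.
apply: linfty_norm_le => n.
rewrite linftyDE linftyNE linftyDE /= /linfty_mul /c.
rewrite linftyME linftyNE linftyME.
rewrite !linfty_invE//.
have hn := linfty_norm_ub h n; move: (hxn n) (ex n); rewrite linftyDE.
move: hn; set a := linfty_fun h n; set b := linfty_fun x n.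
move=> ah hab eb.
have b0 : 0 < b by exact: lt_le_trans eb.
have ab0 : 0 < a + b by apply: lt_le_trans hab; rewrite divr_gt0.
rewrite (_ : _ - _ = (a * a) / (b * b * (a + b))); last first.
  by field; rewrite !gt_eqF.
rewrite normrM normfV (gtr0_norm (x := _ * (a + b))) ?mulr_gt0//.
rewrite ler_pdivrMr ?mulr_gt0//.
have aa : `|a * a| <= `|h| * `|h| by rewrite normrM ler_pM.
rewrite (le_trans aa)// mulrAC ler_wpM2r//.
rewrite (le_trans h2)// ler_wpM2l ?(ltW eps0)//.
have e20 : 0 <= e / 2 by rewrite divr_ge0// ltW.
by rewrite ler_pM ?mulr_ge0 ?ler_pM ?(ltW e0).
Unshelve. all: by end_near. Qed.

(** The tangent map (x, v) |-> - x^-2 v is built from the inverse itself by products, so each order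
    follows from the preceding one. *)
Lemma linfty_inv_Cn n : Cn n linfty_pos linfty_inv.
Proof.
elim: n => [|n IH] /=.
  by move=> x /linfty_inv_diff[+ _]; exact: differentiable_continuous.
split; first by move=> x /linfty_inv_diff[].
have oT := @open_setXT R _ (linfty R) _ open_linfty_pos.
have I : Cn n (linfty_pos `*` [set: linfty R])
    (linfty_inv \o fst).
  apply: (comp_Cn (V := linfty_pos)) => //; first exact: open_linfty_pos.
    by move=> p [].
  by apply: linear_Cn => p; exact: cvg_fst.
apply: (@eq_Cn _ n _ _ _
  (fun p : linfty R * linfty R => -1 *: (linfty_inv p.1 * linfty_inv p.1 * p.2))) => //.
  move=> -[x v] /set_mem[/= xp _].
  rewrite (linfty_inv_diff xp).2 /linfty_mul; apply: linfty_ext => i.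
  by rewrite linftyZE !linftyME linftyNE linftyME; ring.
apply: (@linear_comp_Cn _ n _ _ _ _ _ ( *:%R (-1) : {linear linfty R -> linfty R})) => //.
  exact: scaler_continuous.
apply: mul_Cn => //; first exact: mul_Cn.
by apply: linear_Cn => p; exact: cvg_snd.
Qed.

(** * Linear reindexing operators on l^oo *)

Section Reindex.
Variable f : nat -> option nat.

Fact linfty_reindex_subproof x :
  (fun n => oapp x 0 (f n)) \in @linfty_pred R.
Proof.
have [M xM] := linfty_bounded x; apply/linftyP; exists M => n.
by case: (f n) => //=; rewrite normr0 (le_trans _ (xM 0%N)).
Qed.

(** [None] stands for a vanishing entry. *)
Definition linfty_reindex x : linfty R :=
  exist (fun y : nat -> R => y \in linfty_pred) _ (linfty_reindex_subproof x).

Lemma linfty_reindexE x n : linfty_reindex x n = oapp x 0 (f n).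
Proof. by []. Qed.

Fact linfty_reindex_linear : linear linfty_reindex.
Proof.
move=> a x y; apply: linfty_ext => n.
rewrite linftyDE linftyZE !linfty_reindexE; case: (f n) => //=.
by rewrite mulr0 addr0.
Qed.

HB.instance Definition _ := GRing.isLinear.Build R (linfty R) (linfty R) _
  linfty_reindex linfty_reindex_linear.

(** Every entry of the image is zero or an entry of [x], so the norm does not grow. This covers
    shifts, periodization and insertion of leading zeros at once. *)
Lemma linfty_reindex_continuous : continuous linfty_reindex.
Proof.
apply: (@le_linear_continuous _ _ _ _ 1) => x.
rewrite mul1r; apply: linfty_norm_le => n; rewrite linfty_reindexE.
case: (f n) => /=; first by move=> i; exact: linfty_norm_ub.
by rewrite normr0.
Qed.

End Reindex.

End LinftyCalculus.

(** * Fibers of the orbit map *)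

Section CoadjointAlgebra.
Context {R : realType} {k : nat}.
Hypothesis hk : (2 <= k)%N.
Implicit Types g h : GI R k.

Let m := k.-1.
Let m_gt0 : (0 < m)%N. Proof. by rewrite /m -subn1 subn_gt0. Qed.

Lemma iter_shtE (p : nat) (a : nat -> R) n :
  iter p sht a n = if (n < p)%N then 0 else a (n - p)%N.
Proof.
elim: p n => [|p IH] n; first by rewrite ltn0 subn0.
by case: n => [|n] //=; rewrite IH ltnS subSS.
Qed.

(** The first [m] entries are unaffected by the shifted term; each later one is recovered from the
    entry [m] places before, which comes strictly earlier since [m] is positive. *)
Lemma sub_iter_sht_inj (a b : nat -> R) :
  a - iter m sht a = b - iter m sht b -> a = b.
Proof.
move=> ab; apply/funext => n; elim/ltn_ind: n => n IH.
have := congr1 (@^~ n) ab; rewrite !fctE !iter_shtE.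
case: ltnP => nm; first by rewrite !subr0.
rewrite (IH (n - m)%N); first by move/addIr.
by rewrite ltn_subrL m_gt0 (leq_trans m_gt0 nm).
Qed.

Lemma GI_predE (y : Iinfty R) : (y \in @GI_pred R) = (y.1 \in @linfty_pos R).
Proof. by []. Qed.

Lemma GI0_pos g : linfty_pos (GI0 g).
Proof. by have := valP g; rewrite GI_predE inE. Qed.

(** Equality of the ratios g_0(n+m)/g_0(n) and g_1(n)/g_0(n) for both elements, cross-multiplied.
    Equality of orbit points, of cosets and of normal forms is reduced to it. *)
Definition GI_proportional g h := forall n,
  GI0 g (n + m)%N * GI0 h n = GI0 h (n + m)%N * GI0 g n /\
  GI1 g n * GI0 h n = GI1 h n * GI0 g n.

(** Cancelling the nonzero entries of [nu.2], the second component yields the ratios of g_0; the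
    first yields those of g_1 to g_0, since 1 minus the shift is injective. *)
Lemma coad_eqP (nu : seq2 R) g h : (forall n, nu.2 n != 0) ->
  coad g nu = coad h nu <-> GI_proportional g h.
Proof.
move=> nu0; split=> [E n|gh].
  split.
    have := congr1 (fun p => p.2 n) E; rewrite /coad /= !iter_shE.
    move=> /(mulIf (nu0 n)) /eqP.
    rewrite eqr_div ?GI0_neq0// => /eqP ->.
    by rewrite mulrC.
  have := congr1 fst E; rewrite /coad /= -!addrA.
  move=> /addrI /sub_iter_sht_inj /(congr1 (@^~ n)) /= /(mulIf (nu0 n)).
  rewrite mulrC [RHS]mulrC => /eqP; rewrite eqr_div ?GI0_neq0// => /eqP.
  by [].
have E : (fun n => (GI0 g n)^-1 * GI1 g n * nu.2 n) =
         (fun n => (GI0 h n)^-1 * GI1 h n * nu.2 n).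
  apply/funext => n; congr (_ * _); rewrite mulrC [RHS]mulrC; apply/eqP.
  by rewrite eqr_div ?GI0_neq0// (gh n).2.
rewrite /coad E; congr pair; apply/funext => n; congr (_ * _).
apply/eqP; rewrite eqr_div ?GI0_neq0// !iter_shE (gh n).1.
by [].
Qed.

Lemma GL0P g : GL0 R k g <->
  (forall n, GI1 g n = 0) /\ (forall n, GI0 g (n + m)%N = GI0 g n).
Proof.
split=> [[g1 g0]|[g1 g0]]; split.
- by move=> n; rewrite g1.
- by move=> n; rewrite -[in RHS]g0 iter_linfty_shE.
- exact: linfty_ext.
- by apply: linfty_ext => n; rewrite iter_linfty_shE.
Qed.

(** The components of g^-1 h are h_0/g_0 and h_1/g_0 - (g_1/g_0) s^m(h_0/g_0). Periodicity of the
    former is the first proportion; given it, the latter vanishes exactly when the second one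
    holds. *)
Lemma GL0_mulP g h : GL0 R k (g^-1 * h)%g <-> GI_proportional g h.
Proof.
rewrite GL0P; split=> [[E1 E0] n|gh].
  have e0 := E0 n; have e1 := E1 n.
  move: e0 e1; rewrite !(GI0_mulE, GI1_mulE) !GI0_invE GI1_invE -/m => e0 e1.
  have g0 := GI0_neq0 g n; have gm0 := GI0_neq0 g (n + m).
  have hm0 := GI0_neq0 h (n + m).
  have e0' : GI0 h (n + m)%N * GI0 g n = GI0 g (n + m)%N * GI0 h n.
    have := congr1 (fun t => t * GI0 g n * GI0 g (n + m)%N) e0.
    rewrite (_ : _^-1 * _ * _ * _ = GI0 h (n + m)%N * GI0 g n); last by field.
    by move=> ->; field.
  split=> //.
  have := congr1 (fun t => t * GI0 g n * GI0 g (n + m)%N * GI0 g n) e1.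
  rewrite !mul0r => e.
  have : GI0 g (n + m)%N *
      (GI1 h n * GI0 g n - GI1 g n * GI0 h n) = 0.
    rewrite -[RHS]e.
    transitivity (GI0 g n * GI0 g (n + m)%N * GI1 h n -
        GI1 g n * (GI0 h (n + m)%N * GI0 g n)).
      by rewrite e0'; ring.
    by field; rewrite g0 gm0.
  by move/eqP; rewrite mulf_eq0 (negbTE gm0) /= subr_eq0 => /eqP.
split=> n; have [e0 e1] := gh n;
  rewrite !(GI0_mulE, GI1_mulE) !GI0_invE ?GI1_invE -/m;
  have g0 := GI0_neq0 g n; have gm0 := GI0_neq0 g (n + m).
  rewrite (_ : GI1 h n = GI1 g n * GI0 h n / GI0 g n); last by rewrite e1 mulfK.
  rewrite (_ : GI0 h (n + m)%N = GI0 g (n + m)%N * GI0 h n / GI0 g n).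
    by field; rewrite g0.
  by rewrite e0 mulfK.
rewrite (_ : GI0 h (n + m)%N = GI0 g (n + m)%N * GI0 h n / GI0 g n).
  by field; rewrite g0.
by rewrite e0 mulfK.
Qed.

Lemma GI_proportional1 g : GI_proportional 1%g g <-> GL0 R k g.
Proof. by rewrite -GL0_mulP invg1 mul1g. Qed.

Lemma coad1 (nu : seq2 R) : coad (1%g : GI R k) nu = nu.
Proof.
have E0 n : GI0 (1%g : GI R k) n = 1 by [].
have E1 n : GI1 (1%g : GI R k) n = 0 by [].
case: nu => a b; congr pair => /=.
  have -> : (fun n => (GI0 (1%g : GI R k) n)^-1 * GI1 (1%g : GI R k) n * b n) = 0.
    by apply/funext => n; rewrite E1 mulr0 mul0r.
  apply/funext => n; rewrite !fctE iter_shtE.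
  by rewrite if_same addr0 subr0.
by apply/funext => n; rewrite iter_shE !E0 invr1 !mul1r.
Qed.

Lemma coad_stabilizerE (nu : seq2 R) : (forall n, nu.2 n != 0) ->
  coad_stabilizer k nu = GL0 R k.
Proof.
move=> nu0; apply/seteqP; split=> g /=.
  move=> gnu; apply/GI_proportional1/(coad_eqP _ _ nu0).
  by rewrite coad1; exact: esym gnu.
by move=> /GI_proportional1 /(coad_eqP _ _ nu0) E; rewrite /coad_stabilizer/= -E coad1.
Qed.

Lemma GL0_center g h : GL0 R k g -> (g * h = h * g)%g.
Proof.
move=> /GL0P[g1 g0]; apply: GI_ext => n; rewrite !(GI0_mulE, GI1_mulE).
  by rewrite mulrC.
by rewrite g1 g0 mulr0 mul0r add0r addr0 mulrC.
Qed.

Lemma GI_of_pos_subproof (x y : linfty R) : linfty_pos x ->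
  ((x, y) : Iinfty R) \in @GI_pred R.
Proof. by move=> xp; rewrite GI_predE inE. Qed.

(** Two test elements suffice for each [n]: commuting with 1 + S^m gives z_0(n+m) = z_0(n), and
    commuting with the diagonal element that is 2 at [n] and 1 elsewhere gives z_m(n) = 2 z_m(n),
    because n+m differs from n. *)
Lemma center_GL0 : group_center (GI R k) = GL0 R k.
Proof.
apply/seteqP; split=> [z zc|g gG h]; last exact: GL0_center.
have p1 : linfty_pos (1 : linfty R) by exists 1.
pose g1 : GI R k := exist (fun y => y \in @GI_pred R) _ (GI_of_pos_subproof 1 p1).
apply/GL0P; split=> n; last first.
  have := congr1 (fun g => GI1 g n) (zc g1); rewrite !GI1_mulE.
  rewrite /GI0 /GI1 /= !linfty1E !mulr1 !mul1r => /eqP.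
  by rewrite addrC (inj_eq (addrI _)) => /eqP.
pose w j : R := 1 + (j == n)%:R.
have wl : w \in linfty_pred.
  apply/linftyP; exists 2 => j; rewrite /w; case: (j == n) => /=.
    by rewrite ger0_norm.
  by rewrite addr0 normr1 ler1n.
have wp : linfty_pos (exist (fun y : nat -> R => y \in linfty_pred) w wl).
  by exists 1 => // j; rewrite lerDl.
pose g2 : GI R k := exist (fun y => y \in @GI_pred R) _ (GI_of_pos_subproof 0 wp).
have := congr1 (fun g => GI1 g n) (zc g2); rewrite !GI1_mulE.
have -> : GI1 g2 n = 0 by [].
have -> : GI0 g2 n = 2 by rewrite -[LHS]/(w n) /w eqxx.
have -> : GI0 g2 (n + m)%N = 1.
  by rewrite -[LHS]/(w (n + m)%N) /w -[X in _ == X]addn0 eqn_add2l gtn_eqF// addr0.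
by rewrite mulr0 mul0r add0r addr0 mulr1; lra.
Qed.

End CoadjointAlgebra.

(** * Normal forms of cosets *)

Section NormalForm.
Context {R : realType}.
Variable m : nat.
Hypothesis m_gt0 : (0 < m)%N.
Implicit Types x p : linfty R.
Implicit Types y : linfty R * linfty R.

Definition periodize : linfty R -> linfty R :=
  linfty_reindex (fun n => Some (n %% m)%N).
Definition tail : linfty R -> linfty R :=
  linfty_reindex (fun n => Some (n + m)%N).
Definition prepend0 : linfty R -> linfty R :=
  linfty_reindex (fun n => if (n < m)%N then None else Some (n - m)%N).

Fact head1_subproof : (fun n => (n < m)%N%:R) \in @linfty_pred R.
Proof.
by apply/linftyP; exists 1 => n; case: (n < m)%N; rewrite ?normr1// normr0.
Qed.

(** Affine in [x]: a continuous linear map plus a constant, so smoothness follows from the sum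
    rule. *)
Definition prepend1 x : linfty R :=
  prepend0 x + exist (fun z : nat -> R => z \in linfty_pred) _ head1_subproof.

Lemma prepend1E x n : prepend1 x n = if (n < m)%N then 1 else x (n - m)%N.
Proof.
rewrite linftyDE linfty_reindexE -[X in _ + X]/((n < m)%N%:R).
by case: (n < m)%N => /=; rewrite ?add0r ?addr0.
Qed.

Lemma reindex_pos (f : nat -> nat) x : linfty_pos x ->
  linfty_pos (linfty_reindex (Some \o f) x).
Proof. by move=> [e e0 ex]; exists e => // n; rewrite linfty_reindexE /=. Qed.

Lemma periodize_pos x : linfty_pos x -> linfty_pos (periodize x).
Proof. exact: reindex_pos. Qed.

Lemma tail_pos x : linfty_pos x -> linfty_pos (tail x).
Proof. exact: reindex_pos. Qed.

Lemma prepend1_pos x : linfty_pos x -> linfty_pos (prepend1 x).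
Proof.
move=> [e e0 ex]; exists (Num.min 1 e); first by rewrite lt_min ltr01.
move=> n; rewrite prepend1E ge_min; case: ifP => _; rewrite ?lexx//.
by rewrite ex orbT.
Qed.

Definition pos_pairs : set (linfty R * linfty R) :=
  linfty_pos `*` [set: linfty R].

Lemma open_pos_pairs : open pos_pairs.
Proof. exact/open_setXT/open_linfty_pos. Qed.

(** Dividing [g] by the periodic extension of [g_0(0), ..., g_0(m-1)] makes these
    entries equal to [1]; the others are coordinates on the coset of [g]. *)
Definition normal_form y : linfty R * linfty R :=
  (tail y.1 * linfty_inv (periodize y.1), y.2 * linfty_inv (periodize y.1)).

(** For an [m]-periodic [p] this is the element with leading entries 1 multiplied by the diagonal
    element [p], on which the shift in the product acts trivially. The choice of [p] selects the
    point of the coset. *)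
Definition lift_form p y : linfty R * linfty R :=
  (prepend1 y.1 * p, y.2 * p).

Lemma normal_form1E y n : pos_pairs y ->
  (normal_form y).1 n = y.1 (n + m)%N / y.1 (n %% m)%N.
Proof.
by move=> [y0 _]; rewrite linftyME linfty_invE//; exact: periodize_pos.
Qed.

Lemma normal_form2E y n : pos_pairs y ->
  (normal_form y).2 n = y.2 n / y.1 (n %% m)%N.
Proof.
by move=> [y0 _]; rewrite linftyME linfty_invE//; exact: periodize_pos.
Qed.

Lemma normal_form_pos y : pos_pairs y -> pos_pairs (normal_form y).
Proof.
move=> [y0 _]; split=> //; apply: linfty_posM; first exact: tail_pos.
exact/linfty_inv_pos/periodize_pos.
Qed.

Lemma lift_form_pos p y : linfty_pos p -> pos_pairs y ->
  pos_pairs (lift_form p y).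
Proof.
by move=> p0 [y0 _]; split=> //; apply: linfty_posM => //; exact: prepend1_pos.
Qed.

Lemma linfty_pair_ext (y z : linfty R * linfty R) : (forall n, y.1 n = z.1 n) ->
  (forall n, y.2 n = z.2 n) -> y = z.
Proof.
by case: y z => [? ?] [? ?] /= /linfty_ext -> /linfty_ext ->.
Qed.

(** The leading ones make the first [m] entries of the lift equal to those of [x], so the normal
    form divides by exactly the periodic factor that was put in. *)
Lemma lift_formK x y : linfty_pos x -> pos_pairs y ->
  normal_form (lift_form (periodize x) y) = y.
Proof.
move=> x0 yp; have px := periodize_pos x0.
have lp := lift_form_pos px yp.
have E n : (lift_form (periodize x) y).1 (n %% m)%N = x (n %% m)%N.
  by rewrite linftyME prepend1E ltn_pmod// mul1r linfty_reindexE /= modn_mod.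
have xn0 n := linfty_pos_neq0 (n %% m) x0.
apply: linfty_pair_ext => n.
  rewrite normal_form1E// E linftyME prepend1E ltnNge leq_addl /= addnK.
  by rewrite linfty_reindexE /= modnDr mulfK.
by rewrite normal_form2E// E linftyME linfty_reindexE /= mulfK.
Qed.

Lemma normal_formK y : pos_pairs y ->
  lift_form (periodize y.1) (normal_form y) = y.
Proof.
move=> yp; have [y0 _] := yp; have yn0 n := linfty_pos_neq0 (n %% m) y0.
apply: linfty_pair_ext => n; last first.
  by rewrite linftyME normal_form2E// linfty_reindexE /= divfK.
rewrite linftyME prepend1E linfty_reindexE /=; case: ltnP => nm.
  by rewrite modn_small// mul1r.
rewrite -[linfty_fun (_ * _) _]/((normal_form y).1 (n - m)%N).
rewrite normal_form1E// subnK//.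
by rewrite -[in X in _ / X](modnDr (n - m)) subnK// divfK.
Qed.

Lemma normal_form_Cn n : Cn n pos_pairs normal_form.
Proof.
have oP := open_pos_pairs.
have rC (f : nat -> option nat) :
    Cn n pos_pairs (fun y => linfty_reindex f y.1).
  apply: (@linear_comp_Cn _ n _ _ _ _ fst (linfty_reindex f)) => //.
    exact: linfty_reindex_continuous.
  by apply: linear_Cn => y; exact: cvg_fst.
have iC : Cn n pos_pairs (fun y => linfty_inv (periodize y.1)).
  apply: (@comp_Cn _ n _ _ _ _ linfty_pos (fun y => periodize y.1)) => //.
  - exact: open_linfty_pos.
  - by move=> y [/= y0 _]; exact: periodize_pos.
  - exact: rC.
  - exact: linfty_inv_Cn.
apply: pair_Cn => //; apply: mul_Cn => //; first exact: rC.
by apply: linear_Cn => y; exact: cvg_snd.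
Qed.

Lemma lift_form_Cn n (U : set (linfty R * linfty R)) p : open U ->
  Cn n U (lift_form p).
Proof.
move=> oU; apply: pair_Cn => //; apply: mul_Cn => //; try exact: cst_Cn.
  apply: add_Cn => //; last exact: cst_Cn.
  apply: (@linear_comp_Cn _ n _ _ _ _ fst (linfty_reindex _)) => //.
    exact: linfty_reindex_continuous.
  by apply: linear_Cn => y; exact: cvg_fst.
by apply: linear_Cn => y; exact: cvg_snd.
Qed.

End NormalForm.

(** * Smoothness of the product and the inverse in coordinates *)

Section GroupOperations.
Context {R : realType}.
Variable k : nat.

Local Notation X := (linfty R * linfty R)%type.

Lemma imul_Cn n (E : normedModType R) (U : set E) (f g : E -> X) : open U ->
  Cn n U f -> Cn n U g -> Cn n U (fun z => imul k (f z) (g z)).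
Proof.
move=> oU fC gC.
have c1 (h : E -> X) : Cn n U h -> Cn n U (fun z => (h z).1).
  apply: (@linear_comp_Cn _ n _ _ _ _ h (fst : {linear X -> linfty R})) => //.
  by move=> y; exact: cvg_fst.
have c2 (h : E -> X) : Cn n U h -> Cn n U (fun z => (h z).2).
  apply: (@linear_comp_Cn _ n _ _ _ _ h (snd : {linear X -> linfty R})) => //.
  by move=> y; exact: cvg_snd.
have shE (x : linfty R) : iter k.-1 linfty_sh x = tail k.-1 x.
  by apply: linfty_ext => i; rewrite iter_linfty_shE linfty_reindexE.
rewrite /imul; under eq_fun do rewrite shE.
apply: pair_Cn => //; first by apply: mul_Cn => //; exact: c1.
apply: add_Cn => //; apply: mul_Cn => //; [exact: c1|exact: c2|exact: c2|].
apply: (@linear_comp_Cn _ n _ _ _ _ (fun z => (g z).1) (linfty_reindex _)) => //.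
  exact: linfty_reindex_continuous.
exact: c1.
Qed.

(** The group inverse extended to the whole model space; the sign is a scaling, hence visibly a
    continuous linear map. *)
Definition Iinv (y : X) : X :=
  (linfty_inv y.1, -1 *: (linfty_inv y.1 * y.2 * tail k.-1 (linfty_inv y.1))).

Lemma val_GI_inv (g : GI R k) : val (g^-1)%g = Iinv (val g).
Proof.
have gp := GI0_pos g.
apply: linfty_pair_ext => n; first by rewrite linfty_invE.
rewrite linftyZE !linftyME linfty_reindexE /= !linfty_invE// mulN1r.
exact: GI1_invE.
Qed.

Lemma Iinv_Cn n (E : normedModType R) (U : set E) (f : E -> X) : open U ->
  (forall z, U z -> pos_pairs (f z)) ->
  Cn n U f -> Cn n U (fun z => Iinv (f z)).
Proof.
move=> oU fU fC.
have c1 : Cn n U (fun z => (f z).1).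
  apply: (@linear_comp_Cn _ n _ _ _ _ f (fst : {linear X -> linfty R})) => //.
  by move=> y; exact: cvg_fst.
have c2 : Cn n U (fun z => (f z).2).
  apply: (@linear_comp_Cn _ n _ _ _ _ f (snd : {linear X -> linfty R})) => //.
  by move=> y; exact: cvg_snd.
have iC : Cn n U (fun z => linfty_inv (f z).1).
  apply: (@comp_Cn _ n _ _ _ _ linfty_pos (fun z => (f z).1)) => //.
  - exact: open_linfty_pos.
  - by move=> y /fU[].
  - exact: linfty_inv_Cn.
apply: pair_Cn => //.
apply: (@linear_comp_Cn _ n _ _ _ _ _ ( *:%R (-1) : {linear linfty R -> linfty R})) => //.
  exact: scaler_continuous.
apply: mul_Cn => //; first exact: mul_Cn.
apply: (@linear_comp_Cn _ n _ _ _ _ _ (linfty_reindex _)) => //.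
exact: linfty_reindex_continuous.
Qed.

Lemma imul_pos (y z : X) : pos_pairs y -> pos_pairs z -> pos_pairs (imul k y z).
Proof. by move=> [y0 _] [z0 _]; split=> //; exact: linfty_posM. Qed.

Lemma Iinv_pos (y : X) : pos_pairs y -> pos_pairs (Iinv y).
Proof. by move=> [y0 _]; split=> //; exact: linfty_inv_pos. Qed.

End GroupOperations.

(** * The orbit as a Banach Lie group *)

Section Orbit.
Context {R : realType} {k : nat}.
Variable nu : seq2 R.
Hypothesis hk : (2 <= k)%N.
Hypothesis nu0 : forall n, nu.2 n != 0.
Implicit Types g h : GI R k.

Local Notation X := (linfty R * linfty R)%type.
Local Notation O := (coad_orbit k nu).
Local Notation nf := (normal_form k.-1).

Let m_gt0 : (0 < k.-1)%N.
Proof. by rewrite -subn1 subn_gt0. Qed.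

Lemma val_pos g : pos_pairs (val g : X).
Proof. by split=> //; exact: GI0_pos. Qed.

Lemma pos_pairs_GI (y : X) : pos_pairs y -> y \in @GI_pred R.
Proof. by move=> [y0 _]; rewrite GI_predE inE. Qed.

Lemma GI_insubdK (y : X) : pos_pairs y -> val (insubd (1%g : GI R k) y) = y.
Proof. by move=> yp; rewrite val_insubd pos_pairs_GI. Qed.

Lemma normal_form_eqP g h :
  nf (val g) = nf (val h) <-> GI_proportional g h.
Proof.
have vg := val_pos g; have vh := val_pos h.
have g0 n := GI0_neq0 g n; have h0 n := GI0_neq0 h n.
split=> [E|gh].
  (* This says that h_0/g_0 is [m]-periodic, with [m] for [k.-1]. The normal form gives it from
     index [m] on; below, it is trivial. *)
  have E1 n : GI0 g n * GI0 h (n %% k.-1)%N = GI0 h n * GI0 g (n %% k.-1)%N.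
    have [nm|mn] := ltnP n k.-1; first by rewrite modn_small// mulrC.
    have := congr1 (fun y : X => y.1 (n - k.-1)%N) E.
    rewrite !normal_form1E// subnK// -(modnDr (n - k.-1)) subnK// => /eqP.
    by rewrite eqr_div ?g0 ?h0// => /eqP.
  move=> n; have e1 := E1 n; have := E1 (n + k.-1)%N; rewrite modnDr => e2.
  have := congr1 (fun y : X => y.2 n) E; rewrite !normal_form2E// => /eqP.
  rewrite eqr_div ?g0 ?h0// -/(GI0 g) -/(GI0 h) -/(GI1 g) -/(GI1 h) => /eqP e3.
  (* Indices n and n+m have the same residue, so both proportions follow after multiplying by the
     nonzero entries at that residue. *)
  by split; apply: (mulIf (mulf_neq0 (g0 (n %% k.-1)%N) (h0 (n %% k.-1)%N)));
    ring: e1 e2 e3.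
(* Conversely, the proportions relate entries [m] places apart, and descent reaches the first [m]
   entries. *)
have E1 n : GI0 g n * GI0 h (n %% k.-1)%N = GI0 h n * GI0 g (n %% k.-1)%N.
  elim/ltn_ind: n => n IH.
  have [nm|mn] := ltnP n k.-1; first by rewrite modn_small// mulrC.
  have := (gh (n - k.-1)%N).1; rewrite subnK// => e1.
  have := IH (n - k.-1)%N; rewrite ltn_subrL m_gt0 (leq_trans m_gt0 mn).
  rewrite -(modnDr (n - k.-1)) subnK// => /(_ isT) e2.
  apply: (mulIf (mulf_neq0 (g0 (n - k.-1)%N) (h0 (n - k.-1)%N))).
  ring: e1 e2.
apply: linfty_pair_ext => n.
  rewrite !normal_form1E// -(modnDr n); apply/eqP.
  by rewrite eqr_div ?g0 ?h0//; apply/eqP; exact: E1.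
rewrite !normal_form2E//; apply/eqP; rewrite eqr_div ?g0 ?h0//; apply/eqP.
have e1 := E1 n; have [_ e2] := gh n.
rewrite -/(GI0 g) -/(GI0 h) -/(GI1 g) -/(GI1 h).
apply: (mulIf (mulf_neq0 (g0 n) (h0 n))).
ring: e1 e2.
Qed.

(** * The bijection between the coset space and the orbit *)

Definition orbit_pt g : O := exist _ (coad g nu) (mem_set (imageT _ g)).

Lemma orbit_pt_eqP g h : orbit_pt g = orbit_pt h <-> GI_proportional g h.
Proof.
rewrite -(coad_eqP hk _ _ nu0); split=> [/(congr1 val)//|E]; exact: val_inj.
Qed.

Lemma orbit_pt_surj (t : O) : exists g, orbit_pt g = t.
Proof. by have [g _ gt] := set_mem (valP t); exists g; exact: val_inj. Qed.

Definition orbit_repr (t : O) : GI R k := sval (cid (orbit_pt_surj t)).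

Lemma orbit_reprK : cancel orbit_repr orbit_pt.
Proof. by move=> t; rewrite /orbit_repr; case: cid. Qed.

Lemma left_cosetE g : left_coset (GL0 R k) g = [set h | GI_proportional g h].
Proof.
apply/seteqP; split=> [_ /= [z Gz <-]|h /= gh].
  by apply/GL0_mulP; rewrite mulKg.
by exists (g^-1 * h)%g; [exact/GL0_mulP|rewrite mulVKg].
Qed.

(** Both equalities amount to proportionality, so the two projections have the same fibers. *)
Lemma coset_proj_eqP g h :
  coset_proj (GL0 R k) g = coset_proj (GL0 R k) h <-> orbit_pt g = orbit_pt h.
Proof.
split=> [/(congr1 val)/=|E].
  rewrite !left_cosetE => E; apply/orbit_pt_eqP.
  suff : [set u | GI_proportional g u] h by [].
  by rewrite E => n.
apply: val_inj; rewrite /= !left_cosetE; apply/seteqP.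
by split=> u /= /orbit_pt_eqP H; apply/orbit_pt_eqP; rewrite -H E.
Qed.

Lemma coset_proj_surj (C : coset_space (GL0 R k)) :
  exists g, coset_proj (GL0 R k) g = C.
Proof. by have [g _ gC] := set_mem (valP C); exists g; exact: val_inj. Qed.

Definition coset_repr (C : coset_space (GL0 R k)) : GI R k :=
  sval (cid (coset_proj_surj C)).

Lemma coset_reprK : cancel coset_repr (coset_proj (GL0 R k)).
Proof. by move=> C; rewrite /coset_repr; case: cid. Qed.

Definition coset_orbit (C : coset_space (GL0 R k)) : O :=
  orbit_pt (coset_repr C).

Lemma coset_orbitE g : coset_orbit (coset_proj (GL0 R k) g) = orbit_pt g.
Proof. by apply/coset_proj_eqP; rewrite coset_reprK. Qed.

Lemma coset_orbit_bij : bijective coset_orbit.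
Proof.
exists (fun t => coset_proj (GL0 R k) (orbit_repr t)) => [C|t].
  rewrite -[RHS]coset_reprK; apply/coset_proj_eqP; exact: orbit_reprK.
by rewrite coset_orbitE orbit_reprK.
Qed.

(** * The group law on the orbit *)

Definition orbit_mul (s t : O) : O := orbit_pt (orbit_repr s * orbit_repr t)%g.
Definition orbit_inv (t : O) : O := orbit_pt (orbit_repr t)^-1%g.

Lemma orbit_pt_GL0 g h : orbit_pt g = orbit_pt h <-> exists2 z, GL0 R k z & h = (g * z)%g.
Proof.
rewrite orbit_pt_eqP -GL0_mulP; split=> [gh|[z Gz ->]]; last by rewrite mulKg.
by exists (g^-1 * h)%g => //; rewrite mulVKg.
Qed.

Lemma GL0M g h : GL0 R k g -> GL0 R k h -> GL0 R k (g * h)%g.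
Proof.
move=> /GL0P[g1 g0] /GL0P[h1 h0]; apply/GL0P; split=> n.
  by rewrite GI1_mulE g1 h1 mulr0 mul0r addr0.
by rewrite !GI0_mulE g0 h0.
Qed.

Lemma GL0V g : GL0 R k g -> GL0 R k g^-1%g.
Proof.
move=> /GL0P[g1 g0]; apply/GL0P; split=> n.
  by rewrite GI1_invE g1 mulr0 mul0r oppr0.
by rewrite !GI0_invE g0.
Qed.

(** The chosen representatives differ from [g] and [h] by central factors, which can be moved to the
    right and absorbed. The law is therefore independent of the choice. *)
Lemma orbit_mulE g h : orbit_mul (orbit_pt g) (orbit_pt h) = orbit_pt (g * h)%g.
Proof.
rewrite /orbit_mul; apply/esym/orbit_pt_GL0.
have [z Gz ->] := (orbit_pt_GL0 _ _).1 (esym (orbit_reprK (orbit_pt g))).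
have [w Gw ->] := (orbit_pt_GL0 _ _).1 (esym (orbit_reprK (orbit_pt h))).
exists (z * w)%g; first exact: GL0M.
by rewrite !mulgA -[(g * z * h)%g]mulgA (GL0_center _ Gz) mulgA.
Qed.

Lemma orbit_invE g : orbit_inv (orbit_pt g) = orbit_pt g^-1%g.
Proof.
rewrite /orbit_inv; apply/esym/orbit_pt_GL0.
have [z Gz ->] := (orbit_pt_GL0 _ _).1 (esym (orbit_reprK (orbit_pt g))).
exists z^-1%g; first exact: GL0V.
by rewrite invgM (GL0_center _ (GL0V Gz)).
Qed.

Lemma orbit_mulA : associative orbit_mul.
Proof.
move=> r s t; rewrite -(orbit_reprK r) -(orbit_reprK s) -(orbit_reprK t).
by rewrite !orbit_mulE mulgA.
Qed.

Lemma orbit_mul1 : left_id (orbit_pt 1%g) orbit_mul.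
Proof. by move=> t; rewrite -(orbit_reprK t) orbit_mulE mul1g. Qed.

Lemma orbit_mulV : left_inverse (orbit_pt 1%g) orbit_inv orbit_mul.
Proof.
by move=> t; rewrite -(orbit_reprK t) orbit_invE orbit_mulE mulVg.
Qed.

(** * The global chart of the orbit *)

Definition GI_section (y : X) : GI R k :=
  insubd (1%g : GI R k) (lift_form k.-1 (periodize k.-1 1) y).

Definition orbit_chart : chart O X :=
  Chart setT (fun t => nf (val (orbit_repr t)))
    (fun y => orbit_pt (GI_section y)).

Lemma linfty_pos1 : linfty_pos (1 : linfty R).
Proof. by exists 1. Qed.

(** The lift is positive, so the default of [insubd] is not met. The periodic factor 1 selects the
    representative whose first [k.-1] diagonal entries are 1. *)
Lemma val_GI_section (y : X) : pos_pairs y ->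
  val (GI_section y) = lift_form k.-1 (periodize k.-1 1) y.
Proof.
move=> yp; rewrite val_insubd pos_pairs_GI//.
exact: lift_form_pos (periodize_pos _ linfty_pos1) yp.
Qed.

(** The chart uses an arbitrary representative, but the normal form is constant on fibers. *)
Lemma orbit_chartE g : cmap orbit_chart (orbit_pt g) = nf (val g).
Proof. by apply/normal_form_eqP/orbit_pt_eqP; exact: orbit_reprK. Qed.

Lemma orbit_chartK : cancel (cmap orbit_chart) (cinv orbit_chart).
Proof.
move=> t; rewrite -(orbit_reprK t) orbit_chartE.
apply/orbit_pt_eqP/normal_form_eqP.
have np := normal_form_pos (k.-1) (val_pos (orbit_repr t)).
by rewrite val_GI_section// lift_formK//; exact: linfty_pos1.
Qed.

Lemma orbit_chart_cinvK (y : X) : pos_pairs y ->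
  cmap orbit_chart (cinv orbit_chart y) = y.
Proof.
move=> yp; rewrite orbit_chartE val_GI_section// lift_formK//.
exact: linfty_pos1.
Qed.

Lemma orbit_chart_pos t : pos_pairs (cmap orbit_chart t).
Proof. exact/normal_form_pos/val_pos. Qed.

Lemma orbit_chart_image (A : set O) :
  cmap orbit_chart @` A = pos_pairs `&` cinv orbit_chart @^-1` A.
Proof.
apply/seteqP; split=> [_ [t At <-]|y [yp Ay]].
  split; first exact: orbit_chart_pos.
  by move: At; rewrite -{1}(orbit_chartK t).
by exists (cinv orbit_chart y) => //; exact: orbit_chart_cinvK.
Qed.

Lemma orbit_chart_range : cmap orbit_chart @` [set: O] = pos_pairs.
Proof. by rewrite orbit_chart_image preimage_setT setIT. Qed.

(** The target of the single global chart is the open set [pos_pairs], in which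
    the group law of the orbit reads [normal_form (lift y * lift z)]. *)
Definition orbit_atlas : set (chart O X) := [set orbit_chart].

Lemma orbit_atlasP : is_atlas orbit_atlas.
Proof.
split.
- by move=> t; exists orbit_chart.
- by move=> _ -> t _; exact: orbit_chartK.
- move=> _ _ -> ->; rewrite setIT orbit_chart_range; split.
    exact: open_pos_pairs.
  move=> n; apply: (@eq_Cn _ n _ _ _ idfun); first exact: open_pos_pairs.
    by move=> y /set_mem yp; rewrite -[LHS]orbit_chart_cinvK.
  by apply: linear_Cn => y; exact: cvg_id.
Qed.

Lemma orbit_atlas_open (A : set X) : open A ->
  atlas_open orbit_atlas (cmap orbit_chart @^-1` A).
Proof.
move=> oA _ ->; rewrite setTI orbit_chart_image.
rewrite (_ : _ `&` _ = pos_pairs `&` A).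
  by apply: openI => //; exact: open_pos_pairs.
apply/seteqP; split=> y [yp Ay]; split=> //; have E := orbit_chart_cinvK yp.
  exact: (eq_ind _ A Ay _ E).
exact: (eq_ind_r A Ay E).
Qed.

Lemma orbit_hausdorff : atlas_hausdorff orbit_atlas.
Proof.
move=> s t st.
have : cmap orbit_chart s != cmap orbit_chart t.
  by apply/eqP => E; apply: st; rewrite -(orbit_chartK s) E orbit_chartK.
move: (@norm_hausdorff R X); rewrite open_hausdorff => H /H.
move=> [[A B] /= [/set_mem sA /set_mem tB] [oA oB AB]].
exists (cmap orbit_chart @^-1` A), (cmap orbit_chart @^-1` B); split=> //.
- exact: orbit_atlas_open.
- exact: orbit_atlas_open.
- by rewrite -preimage_setI (eqP AB) preimage_set0.
Qed.

Lemma section_Cn n (E : normedModType R) (U : set E) (f : E -> X) : open U ->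
  Cn n U f -> Cn n U (fun z => lift_form k.-1 (periodize k.-1 1) (f z)).
Proof.
move=> oU fC; apply: (@comp_Cn _ n _ _ _ _ setT f) => //; first exact: openT.
by apply: lift_form_Cn; exact: openT.
Qed.

Lemma orbit_mul_smooth :
  smooth_map (prod_atlas orbit_atlas orbit_atlas) orbit_atlas
    (fun p => orbit_mul p.1 p.2).
Proof.
move=> p _ _ [_ [_ [-> -> ->]]] -> _ _.
pose U : set (X * X) := pos_pairs `*` pos_pairs.
have oU : open U.
  rewrite openE => -[y z] [/= yp zp].
  by exists (pos_pairs, pos_pairs) => //; split; apply: open_nbhs_nbhs; split=> //;
    exact: open_pos_pairs.
exists U; split => //.
- by split; exact: orbit_chart_pos.
- move=> [y z] [/= yp zp].
  exists (cinv orbit_chart y, cinv orbit_chart z) => //.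
  by congr pair; exact: orbit_chart_cinvK.
move=> n.
have lp (y : X) (yp : pos_pairs y) :=
  lift_form_pos k.-1 (periodize_pos k.-1 linfty_pos1) yp.
pose sec := lift_form k.-1 (periodize k.-1 (1 : linfty R)).
apply: (@eq_Cn _ n _ _ _ (nf \o (fun q : X * X => imul k (sec q.1) (sec q.2)))) => //.
  move=> -[y z] /set_mem [/= yp zp].
  (* By [orbit_mulE] the chosen representatives may be replaced by the sections, whose product is an
     explicit formula. *)
  transitivity (cmap orbit_chart (orbit_pt (GI_section y * GI_section z)%g)).
    rewrite orbit_chartE; apply: (congr1 nf).
    by apply: (congr2 (imul k)); apply/esym; exact: val_GI_section.
  by rewrite -orbit_mulE.
apply: (@comp_Cn _ n _ _ _ _ pos_pairs) => //.
- exact: open_pos_pairs.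
- by move=> q [q1 q2]; apply: imul_pos; exact: lp.
- apply: imul_Cn => //; apply: section_Cn => //; apply: linear_Cn => q.
  + exact: cvg_fst.
  + exact: cvg_snd.
- exact: normal_form_Cn.
Qed.

Lemma orbit_inv_smooth : smooth_map orbit_atlas orbit_atlas orbit_inv.
Proof.
move=> t _ _ -> -> _ _; exists pos_pairs; split => //.
- exact: open_pos_pairs.
- exact: orbit_chart_pos.
- by rewrite orbit_chart_range.
move=> n.
have lp (y : X) (yp : pos_pairs y) :=
  lift_form_pos k.-1 (periodize_pos k.-1 linfty_pos1) yp.
have oP := @open_pos_pairs R.
pose sec := lift_form k.-1 (periodize k.-1 (1 : linfty R)).
apply: (@eq_Cn _ n _ _ _ (nf \o (fun y => Iinv k (sec y)))) => //.
  move=> y /set_mem yp.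
  transitivity (cmap orbit_chart (orbit_pt (GI_section y)^-1%g)).
    by rewrite orbit_chartE val_GI_inv val_GI_section.
  by rewrite -orbit_invE.
apply: (@comp_Cn _ n _ _ _ _ pos_pairs) => //.
- by move=> y yp; apply: Iinv_pos; exact: lp.
- by apply: Iinv_Cn => //; exact: lift_form_Cn.
- exact: normal_form_Cn.
Qed.

Definition orbit_lie_group : banach_lie_group R O :=
  @BanachLieGroup R O orbit_mul (orbit_pt 1%g) orbit_inv
    orbit_mulA orbit_mul1 orbit_mulV X orbit_atlas orbit_atlasP
    orbit_hausdorff orbit_mul_smooth orbit_inv_smooth.

Lemma chart_orbit_ptE (y : X) : pos_pairs y ->
  (cmap orbit_chart \o orbit_pt \o cinv (GI_chart R k)) y = nf y.
Proof.
move=> yp.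
transitivity (cmap orbit_chart (orbit_pt (insubd (1%g : GI R k) y))) => //.
by rewrite orbit_chartE GI_insubdK.
Qed.

(** [lift_form] with the periodic factor of [g] is a smooth local section of the
    projection passing through [g]; its differential is the right inverse. *)
Lemma orbit_pt_submersion :
  submersion (GI_atlas R k) orbit_atlas orbit_pt.
Proof.
have oP := @open_pos_pairs R.
split.
  move=> g _ _ -> -> _ _; exists pos_pairs; split => //.
  - exact: val_pos.
  - move=> y yp; exists (cinv (GI_chart R k) y) => //.
    exact: GI_insubdK.
  move=> n; apply: (@eq_Cn _ n _ _ _ nf) => //; last exact: normal_form_Cn.
  by move=> y /set_mem yp; rewrite chart_orbit_ptE.
move=> g _ _ -> -> _ _.
have gp := val_pos g.
set y := cmap (GI_chart R k) g; pose s := lift_form k.-1 (periodize k.-1 (GI0 g)).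
have syE : s (nf y) = y by exact: normal_formK.
have ds : differentiable s (nf y).
  exact: (Cn_differentiable (lift_form_Cn _ 1 _ openT)).
have dn : differentiable nf y.
  exact: Cn_differentiable (normal_form_Cn _ 1) _.
have near_pos (z : X) : pos_pairs z -> \forall w \near z, pos_pairs w.
  by move=> zp; apply: open_nbhs_nbhs; split.
have [_ nE] : differentiable (cmap orbit_chart \o orbit_pt \o cinv (GI_chart R k)) y
    /\ 'd (cmap orbit_chart \o orbit_pt \o cinv (GI_chart R k)) y = 'd nf y :> (X -> X).
  apply: diff_near_eq dn; near=> z; rewrite chart_orbit_ptE//.
  by near: z; exact: near_pos.
have cid : continuous (idfun : X -> X) by move=> z; exact: cvg_id.
(* The section identity holds on the open set of positive pairs, which contains [nf y];
   differentiating it there gives the identity. *)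
have nsE : 'd (nf \o s) (nf y) = idfun :> (X -> X).
  have did := @linear_differentiable _ X X idfun (nf y) cid.
  have nsid : \forall z \near nf y, idfun z = (nf \o s) z.
    near=> z; have zp : pos_pairs z.
      by near: z; apply/near_pos/normal_form_pos.
    exact: esym (lift_formK m_gt0 (GI0_pos g) zp).
  rewrite (diff_near_eq nsid did).2.
  exact: diff_lin.
exists ('d s (nf y)); first exact: diff_continuous.
have dns : 'd (nf \o s) (nf y) = 'd nf y \o 'd s (nf y) :> (X -> X).
  by rewrite -[in 'd nf y]syE; apply: diff_comp; rewrite ?syE.
move=> v; apply: (etrans (congr1 (@^~ ('d s (nf y) v)) nE)).
exact: (etrans (esym (congr1 (@^~ v) dns)) (congr1 (@^~ v) nsE)).
Unshelve. all: by end_near. Qed.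

End Orbit.

(** * Translation of orbits by the diagonal part *)

Lemma coad_translate (R : realType) (k : nat) (g : GI R k) (nu : seq2 R) :
  coad g nu = (nu.1, 0) + coad g (0, nu.2).
Proof.
case: nu => a b; congr pair; rewrite /coad /=; last by rewrite add0r.
by rewrite add0r addrA.
Qed.

Lemma coad_orbit_translate (R : realType) (k : nat) (nu : seq2 R) :
  coad_orbit k nu = [set (nu.1, 0) + rho | rho in coad_orbit k (0, nu.2)].
Proof.
apply/seteqP; split=> [_ [g _ <-]|_ [_ [g _ <-] <-]].
  by exists (coad g (0, nu.2)); [exists g|rewrite -coad_translate].
by exists g => //; exact: coad_translate.
Qed.

Theorem proposition6p1 (R : realType) (k : nat) (hk : (2 <= k)%N)
    (nu : seq2 R) (nu_predual : predual nu)
    (nu_generic : forall n, nu.2 n != 0) :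
  [/\ (* (i) *)
      group_center (GI R k) = coad_stabilizer k nu /\
      coad_stabilizer k nu = GL0 R k,
      (* (ii) *)
      exists phi : coset_space (GL0 R k) -> coad_orbit k nu,
        [/\ bijective phi,
            forall g : GI R k, val (phi (coset_proj (GL0 R k) g)) = coad g nu &
            exists L : banach_lie_group R (coad_orbit k nu),
              (forall g h : GI R k,
                 blg_mul L (phi (coset_proj (GL0 R k) g))
                           (phi (coset_proj (GL0 R k) h)) =
                 phi (coset_proj (GL0 R k) (g * h)%g)) /\
              submersion (GI_atlas R k) (blg_atlas L)
                (fun g => phi (coset_proj (GL0 R k) g))] &
      (* (iii) *)
      coad_orbit k nu =
        [set (nu.1, 0) + rho | rho in coad_orbit k (0, nu.2)]].
Proof.
split; [split| |exact: coad_orbit_translate].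
- by rewrite center_GL0// coad_stabilizerE.
- by rewrite coad_stabilizerE.
exists (coset_orbit nu); split.
- exact: coset_orbit_bij.
- by move=> g; rewrite coset_orbitE.
exists (orbit_lie_group hk nu_generic); split.
  by move=> g h; rewrite !coset_orbitE// -orbit_mulE.
(* The projection to the coset space followed by the bijection is the orbit map itself. *)
rewrite (_ : (fun g => _) = @orbit_pt R k nu); last first.
  by apply/funext => g; rewrite coset_orbitE.
exact: orbit_pt_submersion.
Qed.
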